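(* Let $G$ be a finite simple graph, let $\Delta_G$ be its independence complex, and let $F_1,F_2,\dots,F_q$ be the facets of $\Delta_G$, so that $\Delta_G=\langle F_1,F_2,\dots,F_q\rangle$. Then the complement $\overline{G}$ is a $(d_1,d_2,\dots,d_q)$-tree for some non-increasing sequence $(d_1,d_2,\dots,d_q)$ of positive integers if and only if $\Delta_G$ is a vertex decomposable (hence shellable and sequentially Cohen--Macaulay) quasi-forest simplicial complex.
   Context: Graphs are finite and simple, with nonempty vertex set. The complement $\overline{G}$ has the same vertex set as $G$, and two distinct vertices are adjacent in $\overline{G}$ iff they are not adjacent in $G$. The independence complex $\Delta_G$ is the simplicial complex of all independent sets of $G$ (equivalently, of all cliques of $\overline{G}$). $\mathcal{K}_r$ denotes the complete graph on $r$ vertices. $\langle F_1,\dots,F_q\rangle$ denotes the simplicial complex with facets (maximal faces) $F_1,\dots,F_q$. $(d_1,\dots,d_q)$-trees: let $(d_1,d_2,\dots,d_q)$ be a non-increasing sequence of positive integers. A $(d_1,d_2,\dots,d_q)$-tree is a graph $H$ constructed inductively as follows: $H_1=\mathcal{K}_{d_1}$; for $2\le i\le q$, $H_i=H_{i-1}\bigcup_{\mathcal{K}_{d_i-1}}\mathcal{K}_{d_i}$, i.e. $H_i$ is obtained from $H_{i-1}$ by gluing a complete graph on $d_i$ vertices along a complete subgraph of $H_{i-1}$ on $d_i-1$ vertices (equivalently, adding one new vertex adjacent exactly to the vertices of a clique of $H_{i-1}$ of size $d_i-1$; when $d_i=1$ the new vertex is isolated in $H_i$); and $H=H_q$. Quasi-forest: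 a facet $F$ of a simplicial complex $\Delta$ is a leaf if either $F$ is the only facet of $\Delta$, or there is a facet $M\ne F$ of $\Delta$ such that $N\cap F\subseteq M\cap F$ for every facet $N\neq F$ of $\Delta$. $\Delta$ is a quasi-forest if its facets can be ordered $F_1,\dots,F_q$ so that $F_i$ is a leaf of $\langle F_1,\dots,F_i\rangle$ for each $i=1,\dots,q$. Vertex decomposable (not necessarily pure): for a vertex $v$ of $\Delta$, $\operatorname{del}_\Delta(v)=\{E\in\Delta\mid v\notin E\}$ and $\operatorname{link}_\Delta(v)=\{E\in\Delta\mid v\notin E,\ E\cup\{v\}\in\Delta\}$. $\Delta$ is vertex decomposable if $\Delta$ is empty, or $\Delta$ is a simplex (has only one facet), or there is a vertex $v$ such that (i) $\operatorname{del}_\Delta(v)$ and $\operatorname{link}_\Delta(v)$ are both vertex decomposable and (ii) no facet of $\operatorname{link}_\Delta(v)$ is a facet of $\operatorname{del}_\Delta(v)$. Shellable (not necessarily pure): the facets can be ordered $F_1,\dots,F_r$ so that for all $1\le i<j\le r$ there exist $v\in F_j\setminus F_i$ and $1\le k<j$ with $F_j\setminus F_k=\{v\}$. Sequentially Cohen--Macaulay: $\Delta$ is sequentially Cohen--Macaulay (over a field $\mathbb{K}$) if its Stanley--Reisner ring $N=\mathbb{K}[\Delta]$ has a finite filtration of graded modules over the polynomial ring, $0=N_0\subset N_1\subset\dots\subset N_r=N$, with each $N_i/N_{i-1}$ Cohen--Macaulay and $\dim N_1/N_0<\dim N_2/N_1<\dots<\dim N_r/N_{r-1}$. *)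

(* Defs.v *)
From HB Require Import structures.
From mathcomp Require Import all_boot all_order all_algebra.
From mathcomp Require Import mpoly.

Set Implicit Arguments.
Unset Strict Implicit.
Unset Printing Implicit Defensive.

Import GRing.Theory.

Section Graphs.

Variables (T : finType) (e : rel T).

Definition compl_rel : rel T := fun u v => (u != v) && ~~ e u v.

Definition clique (U : {set T}) : Prop := {in U &, forall u v, u != v -> e u v}.

(* [tree_steps ds U]: the subgraph of [(T, e)] induced on [U] is obtained by
   the construction H_1, ..., H_q with sizes [ds] = d_1, ..., d_q.  Each H_i is
   an induced subgraph of the final graph H, so the stages are represented by
   their vertex sets. *)
Inductive tree_steps : seq nat -> {set T} -> Prop :=
| Tree_first d (U : {set T}) of #|U| = d & clique U : tree_steps [:: d] U
| Tree_glue ds d (U C : {set T}) v of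
    tree_steps ds U & v \notin U &
    C \subset U & clique C & #|C| = d.-1 &
    {in U, forall u, (e v u = (u \in C)) /\ (e u v = (u \in C))} :
  tree_steps (rcons ds d) (v |: U).

Definition dtree (ds : seq nat) : Prop :=
  [/\ sorted geq ds, all (leq 1) ds & tree_steps ds [set: T]].

Definition independence_complex : {set {set T}} :=
  [set A : {set T} | [forall u in A, forall v in A, ~~ e u v]].

End Graphs.

Section Complexes.

Variable T : finType.
Implicit Types (D : {set {set T}}) (E F : {set T}) (v : T).

Definition facets D : {set {set T}} :=
  [set F | maxset (fun E : {set T} => E \in D) F].

Definition complex_of (s : seq {set T}) : {set {set T}} :=
  [set E : {set T} | has (fun F => E \subset F) s].

Definition leaf D F : Prop :=
  F \in facets D /\
  (facets D = [set F] \/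
   exists M, [/\ M \in facets D, M != F &
     {in facets D, forall N, N != F -> N :&: F \subset M :&: F}]).

Definition quasi_forest D : Prop :=
  exists s : seq {set T}, perm_eq s (enum (facets D)) /\
    forall i, i < size s -> leaf (complex_of (take i.+1 s)) (nth set0 s i).

Definition del D v : {set {set T}} := [set E : {set T} in D | v \notin E].

(* [E \in D] follows from [v |: E \in D], complexes being closed under subsets. *)
Definition link D v : {set {set T}} :=
  [set E : {set T} | (v \notin E) && (v |: E \in D)].

Inductive vertex_decomposable : {set {set T}} -> Prop :=
| VD_empty : vertex_decomposable set0
| VD_simplex D of #|facets D| = 1 : vertex_decomposable D
| VD_shed D v of
    [set v] \in D & vertex_decomposable (del D v) &
    vertex_decomposable (link D v) &
    {in facets (link D v), forall F, F \notin facets (del D v)} :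
  vertex_decomposable D.

Definition shellable D : Prop :=
  exists s : seq {set T}, perm_eq s (enum (facets D)) /\
    forall i j, i < j -> j < size s ->
      exists v k, [/\ v \in nth set0 s j :\: nth set0 s i, k < j &
        nth set0 s j :\: nth set0 s k = [set v]].

End Complexes.

Local Open Scope ring_scope.

(* Modules over [R] are represented as quotients [A / B] of ideals [B] included
   in [A].  In particular the submodules of [R / I] are the [J / I] with [J] an
   ideal containing [I], and (J' / I) / (J / I) = J' / J. *)
Section Modules.

Variable R : comNzRingType.
Implicit Types (A B G I J m : R -> Prop) (x y : R).

Definition ideal J : Prop :=
  [/\ J 0, forall x y, J x -> J y -> J (x + y) & forall x y, J y -> J (x * y)].

Definition ideal_gen G : R -> Prop :=
  fun y => forall J, ideal J -> (forall x, G x -> J x) -> J y.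

Definition prime_ideal J : Prop :=
  [/\ ideal J, ~ J 1 & forall x y, J (x * y) -> J x \/ J y].

Definition ann A B : R -> Prop := fun x => forall a, A a -> B (x * a).

(* Strict chains P 0 < ... < P d of primes containing [ann A B]. *)
Definition prime_chain A B (d : nat) (P : nat -> R -> Prop) : Prop :=
  (forall i, (i <= d)%N -> prime_ideal (P i) /\ forall x, ann A B x -> P i x) /\
  (forall i, (i < d)%N ->
     (forall x, P i x -> P i.+1 x) /\ exists x, P i.+1 x /\ ~ P i x).

Definition krull_dim A B (d : nat) : Prop :=
  (exists P, prime_chain A B d P) /\
  forall d' P, prime_chain A B d' P -> (d' <= d)%N.

(* The ideal B + x A, so that (A / B) / x (A / B) = A / (B + x A). *)
Definition add_mul B x A : R -> Prop :=
  fun y => exists b a, [/\ B b, A a & y = b + x * a].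

(* [xs] is a regular sequence on A / B; the base case says that the quotient
   of A / B by the whole sequence is nonzero. *)
Fixpoint regular_seq (xs : seq R) A B : Prop :=
  if xs is x :: xs' then
    (forall a, A a -> B (x * a) -> B a) /\ regular_seq xs' A (add_mul B x A)
  else exists a, A a /\ ~ B a.

Definition depth m A B (k : nat) : Prop :=
  (exists xs, [/\ size xs = k, {in xs, forall x, m x} & regular_seq xs A B]) /\
  forall xs, {in xs, forall x, m x} -> regular_seq xs A B -> (size xs <= k)%N.

Definition cohen_macaulay m A B : Prop :=
  exists d, krull_dim A B d /\ depth m A B d.

End Modules.

Section StanleyReisner.

Variables (K : fieldType) (T : finType).

Local Notation S := {mpoly K[#|T|]}.

Definition vertex_monomial (E : {set T}) : S := \prod_(v in E) 'X_(enum_rank v).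

Definition stanley_reisner_ideal (D : {set {set T}}) : S -> Prop :=
  ideal_gen (fun p : S => exists2 E, E \notin D & p = vertex_monomial E).

Definition irrelevant_ideal : S -> Prop :=
  ideal_gen (fun p : S => exists i : 'I_#|T|, p = 'X_i).

Definition graded_ideal (J : S -> Prop) : Prop :=
  ideal J /\ forall p k, J p -> J (pihomog mdeg k p).

(* The filtration N_0, ..., N_r of K[D] = S / I is given by the preimages in S
   of its terms, so that N_0 = 0 and N_r = K[D] become [N 0 = I] and [N r = S]. *)
Definition sequentially_cohen_macaulay (D : {set {set T}}) : Prop :=
  exists (r : nat) (N : nat -> S -> Prop),
  [/\ forall i, (i <= r)%N -> graded_ideal (N i),
      (forall p, N 0%N p <-> stanley_reisner_ideal D p) /\ (forall p, N r p),
      forall i, (i < r)%N -> forall p, N i p -> N i.+1 p,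
      forall i, (i < r)%N -> cohen_macaulay irrelevant_ideal (N i.+1) (N i) &
      forall i c d, (i.+1 < r)%N ->
        krull_dim (N i.+1) (N i) c -> krull_dim (N i.+2) (N i.+1) d -> (c < d)%N].

End StanleyReisner.

(* Main.v *)
Require Import Defs.
From HB Require Import structures.
From mathcomp Require Import all_boot all_order all_algebra.
From mathcomp Require Import ring zify.
From mathcomp Require mpoly.

Set Implicit Arguments.
Unset Strict Implicit.
Unset Printing Implicit Defensive.

(** A tree [H_q] is built by attaching vertices to cliques.  Because the sizes
    do not increase, the clique [C] to which a vertex [v] is attached is smaller
    than every facet present, so it is not a facet: each step adds the one facet
    [v |: C], which is a leaf, and [v] is a shedding vertex whose link is a
    simplex and whose deletion is the previous stage ([tree_facets]).

    Conversely, a vertex decomposable complex is shellable, by a shelling of the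
    deletion followed by one of the link ([vertex_decomposable_shellable]), and
    a shelling can be sorted by decreasing size of the facets
    ([shellable_sorted]).  Let [F] be a facet of a sorted shelling.  If [F] met
    the earlier facets in two ridges, missing distinct vertices [v] and [w], put
    [E := F :\: [set v; w]].  The earlier facets through [E] have at least
    [#|E| + 2] vertices, hence they hang together through vertices outside [E]
    ([constant_on_star]), and they join [w] to [v] without using the edge [vw].
    In a quasi-forest such a detour is excluded by a colouring built along the
    leaf order, which separates [v] from [w] and is constant on the facets that
    do not contain the edge [vw] ([leaf_order_coloring]).  So each facet adds
    exactly one vertex to the earlier ones ([fresh_vertex]), and the sorted
    shelling is the construction of a tree ([tree_of_sorted_shelling]).

    For the algebra, let [P_F] be the prime generated by the variables outside
    [F], so that the Stanley-Reisner ideal is the intersection of the [P_F] over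
    the facets.  Intersecting over longer and longer prefixes of a sorted
    shelling [F_0, F_1, ...] gives a chain of ideals whose k-th quotient is
    cyclic, generated by a monomial with annihilator [P_{F_k}]
    ([pure_shelling_step]).  Hence the quotients of the filtration by dimension
    are iterated extensions of rings [S / P_F] with all [#|F|] equal to some [d]
    ([pure_layer]), and it remains to see that such a module is Cohen-Macaulay
    of dimension [d] ([pure_cohen_macaulay]).

    - Depth at least [d]: the elementary symmetric polynomial [e_d] is, modulo
      [P_F], the product of the variables of [F].  So it is regular, and the
      quotient by it is again such an iterated extension, for [d - 1]
      ([pure_quotient]).  Thus [e_d, ..., e_1] is a regular sequence, over any
      field.
    - Depth and dimension at most [d]: any [d + 1] elements are algebraically
      dependent modulo [P_F], by counting monomials.  Of the relation only its
      trailing term is needed, as in the Coquand-Lombardi characterization of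
      Krull dimension ([trailing_in_face_ideal]); it contradicts both a longer
      chain of primes and a longer regular sequence ([prime_chain_trailing],
      [regular_seq_trailing]).
    - Dimension at least [d]: adjoin to [P_F] the variables of [F] one at a
      time ([pure_krull_dim]). *)

(** * Facets, shellings and shedding vertices *)

Section Shellings.

Variable T : finType.
Implicit Types (D : {set {set T}}) (E F G H : {set T}) (v : T).
Implicit Types s t : seq {set T}.

(** Facets are compared by their position in [s] instead of being numbered, so
    that the order can be changed without renaming. *)
Definition shelling_step s F G :=
  exists v H, [/\ v \in F :\: G, H \in s, index H s < index F s &
                  F :\: H = [set v]].

Definition shelling s :=
  forall F G, F \in s -> G \in s -> index G s < index F s ->
  shelling_step s F G.

Lemma shelling_nth s : uniq s ->
  shelling s <->
  (forall i j, i < j -> j < size s ->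
     exists v k, [/\ v \in nth set0 s j :\: nth set0 s i, k < j &
       nth set0 s j :\: nth set0 s k = [set v]]).
Proof.
move=> us; split=> [sh i j ij js | sh F G sF sG GF].
- have is_ := ltn_trans ij js.
  have [|v [H [vFG sH HF FH]]] :=
    sh _ _ (mem_nth set0 js) (mem_nth set0 is_).
    by rewrite !index_uniq.
  exists v, (index H s); rewrite nth_index //; split=> //.
  by move: HF; rewrite index_uniq.
- have := sh _ _ GF; rewrite index_mem => /(_ sF) [v [k]].
  rewrite !nth_index // => -[vFG kF Fk].
  have ks : k < size s by apply: ltn_trans kF _; rewrite index_mem.
  exists v, (nth set0 s k); split; rewrite ?mem_nth ?index_uniq //.
Qed.

Lemma shellableP D :
  shellable D <-> exists s, perm_eq s (enum (facets D)) /\ shelling s.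
Proof.
by split=> -[s [ps sh]]; exists s; split=> //;
  apply/shelling_nth => //; rewrite (perm_uniq ps) enum_uniq.
Qed.

Definition down_closed D := forall E F, E \subset F -> F \in D -> E \in D.

Definition antichain s := {in s &, forall F G, F \subset G -> F = G}.

Lemma facetsP D F :
  reflect (F \in D /\ forall G, G \in D -> F \subset G -> G = F)
          (F \in facets D).
Proof. by rewrite inE; apply: (iffP maxsetP). Qed.

Lemma facets_sub D F : F \in facets D -> F \in D.
Proof. by case/facetsP. Qed.

Lemma facets_antichain D F G :
  F \in facets D -> G \in facets D -> F \subset G -> F = G.
Proof. by move=> /facetsP[_ mF] /facets_sub DG /(mF _ DG). Qed.

Lemma sub_facet D E : E \in D -> exists2 F, F \in facets D & E \subset F.
Proof.
move=> DE; have [F mF EF] := @maxset_exists _ (mem D) E DE.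
by exists F => //; rewrite inE.
Qed.

Lemma mem_facets_seq D s F :
  perm_eq s (enum (facets D)) -> (F \in s) = (F \in facets D).
Proof. by move/perm_mem=> ->; rewrite mem_enum. Qed.

Lemma facets_seq_antichain D s :
  perm_eq s (enum (facets D)) -> antichain s.
Proof.
move=> ps F G; rewrite !(mem_facets_seq _ ps); exact: facets_antichain.
Qed.

Section Shedding.

Variables (D : {set {set T}}) (v : T).
Hypotheses (cD : down_closed D)
  (shed : {in facets (link D v), forall F, F \notin facets (del D v)}).

Lemma del_closed : down_closed (del D v).
Proof.
move=> E F EF; rewrite !inE => /andP[DF vF]; rewrite (cD EF DF) /=.
by apply: contra vF; apply: (subsetP EF).
Qed.

Lemma link_closed : down_closed (link D v).
Proof.
move=> E F EF; rewrite !inE => /andP[vF DF]; rewrite (cD _ DF) ?setUS // andbT.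
by apply: contra vF; apply: (subsetP EF).
Qed.

Lemma link_sub_del F : F \in link D v -> F \in del D v.
Proof. by rewrite !inE => /andP[-> DF]; rewrite (cD _ DF) ?subsetUr. Qed.

(** A facet of the deletion could only be enlarged by [v]; it would then be a
    facet of the link as well, which the shedding condition excludes. *)
Lemma facets_del_sub F : F \in facets (del D v) -> F \in facets D.
Proof.
move=> fF; have /facetsP[] := fF; rewrite inE => /andP[DF vF] mF.
apply/facetsP; split=> // G DG FG; apply: mF => //; rewrite inE DG /=.
apply/negP=> vG; have lF : F \in link D v.
  by rewrite inE vF (cD _ DG) // subUset sub1set vG.
have [L fL FL] := sub_facet lF.
have dL := link_sub_del (facets_sub fL).
have LF : L = F by have /facetsP[_] := fF; apply.
by move: (shed fL); rewrite LF fF.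
Qed.

Lemma facets_link_sub F : F \in facets (link D v) -> v |: F \in facets D.
Proof.
move=> /facetsP[]; rewrite inE => /andP[vF DF] mF.
apply/facetsP; split=> // G DG; rewrite subUset sub1set => /andP[vG FG].
have vGG : v |: (G :\ v) = G by rewrite setD1K.
rewrite -(mF (G :\ v)) //; first by rewrite inE vGG setD11 DG.
by rewrite subsetD1 FG.
Qed.

Lemma facets_shed F :
  (F \in facets D) =
  (F \in facets (del D v)) || (F \in [set v |: L | L in facets (link D v)]).
Proof.
apply/idP/orP => [fF | [/facets_del_sub //|/imsetP[L fL ->]]]; last first.
  exact: facets_link_sub.
have [/facetsP[DF mF] [vF | vF]] := (fF, boolP (v \in F)).
- right; apply/imsetP; exists (F :\ v); last by rewrite setD1K.
  apply/facetsP; rewrite inE setD11 setD1K //; split=> // G.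
  rewrite inE => /andP[vG DG] FG.
  rewrite -(mF _ DG) ?setU1K // -(setD1K vF) subUset sub1set setU11 /=.
  by rewrite (subset_trans FG) // subsetUr.
- left; apply/facetsP; rewrite inE DF; split=> // G; rewrite inE => /andP[DG _].
  exact: mF.
Qed.

(** The facets through [v] come last.  Such a facet [v |: L] meets the part
    without [v] in [L], which lies in a facet of the deletion; so the step from
    [v |: L] to any facet without [v] removes [v]. *)
Lemma shellable_shed :
  shellable (del D v) -> shellable (link D v) -> shellable D.
Proof.
move=> /shellableP[s1 [p1 sh1]] /shellableP[s2 [p2 sh2]]; apply/shellableP.
have v1 F : F \in s1 -> v \notin F.
  by rewrite (mem_facets_seq _ p1) => /facets_sub; rewrite inE => /andP[].
have v2 F : F \in s2 -> v \notin F.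
  by rewrite (mem_facets_seq _ p2) => /facets_sub; rewrite inE => /andP[].
have inj2 : {in s2 &, injective (fun F : {set T} => v |: F)}.
  by move=> F G sF sG eFG; rewrite -(setU1K (v2 _ sF)) eFG setU1K ?v2.
have u1 : uniq s1 by rewrite (perm_uniq p1) enum_uniq.
have u2 : uniq s2 by rewrite (perm_uniq p2) enum_uniq.
pose s := s1 ++ [seq v |: F | F <- s2]; exists s.
have n1 L : v |: L \notin s1 by apply/negP=> /v1; rewrite setU11.
have us : uniq s.
  rewrite cat_uniq u1 map_inj_in_uniq // u2 andbT /=.
  by apply/hasPn=> _ /mapP[L _ ->]; apply: n1.
have i1 F : F \in s1 -> index F s = index F s1 by rewrite index_cat => ->.
have i2 L : L \in s2 -> index (v |: L) s = size s1 + index L s2.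
  move=> sL; rewrite index_cat (negbTE (n1 L)); congr (_ + _).
  elim: (s2) sL inj2 => //= L' s' IH; rewrite inE eq_sym => LL' inj.
  case: eqP LL' => [->|nLL' /= sL]; first by rewrite eqxx.
  case: eqP => [/inj E|_]; last first.
    rewrite IH // => F G sF sG; apply: inj; rewrite inE ?sF ?sG orbT //.
  by case: nLL'; apply: E; rewrite inE ?eqxx ?sL ?orbT.
split.
  apply: uniq_perm; rewrite ?enum_uniq // => F.
  rewrite mem_enum facets_shed mem_cat (mem_facets_seq _ p1); congr (_ || _).
  apply/mapP/imsetP=> -[L sL ->]; exists L => //.
    by rewrite -(mem_facets_seq _ p2).
  by rewrite (mem_facets_seq _ p2).
move=> F G; rewrite !mem_cat => /orP[sF|/mapP[L sL ->]].
  move=> sG; rewrite (i1 F) // => GF.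
  have sG1 : G \in s1.
    case/orP: sG => // /mapP[L sL GE]; move: GF; rewrite GE i2 // => GF.
    by have := leq_trans GF (index_size _ _); rewrite -ltn_subRL subnn.
  move: GF; rewrite i1 // => GF; have [w [H [wFG sH HF FH]]] := sh1 _ _ sF sG1 GF.
  exists w, H; split=> //; first by rewrite mem_cat sH.
  by rewrite !i1.
case/orP=> [sG _ | /mapP[K sK ->]]; last first.
  rewrite !i2 // ltn_add2l => KL; have [w [H [wFG sH HF FH]]] := sh2 _ _ sL sK KL.
  have DU (A B : {set T}) : v \notin A -> (v |: A) :\: (v |: B) = A :\: B.
    move=> vA; apply/setP=> x; rewrite !inE negb_or.
    by case: eqP => [->|_]; rewrite ?(negbTE vA) ?andbF.
  exists w, (v |: H); rewrite !DU ?v2 //; split=> //.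
    by rewrite mem_cat map_f ?orbT.
  by rewrite !i2 // ltn_add2l.
have lL : L \in link D v.
  by move: sL; rewrite (mem_facets_seq _ p2) => /facets_sub.
have [H fH LH] := sub_facet (link_sub_del lL).
have sH : H \in s1 by rewrite (mem_facets_seq _ p1).
exists v, H; split; first by rewrite !inE eqxx v1.
- by rewrite mem_cat sH.
- by rewrite i1 // i2 // (leq_trans _ (leq_addr _ _)) // index_mem.
apply/setP=> x; rewrite !inE; case: eqP => [->|_] /=; first by rewrite v1.
by apply/andP=> -[xH /(subsetP LH)]; apply/negP.
Qed.

End Shedding.

Lemma vertex_decomposable_shellable D :
  down_closed D -> vertex_decomposable D -> shellable D.
Proof.
move=> cD vdD; elim: vdD cD => {D} [_|D f1 _|D v Dv _ IHd _ IHl shed cD].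
- apply/shellableP; exists (enum (facets (set0 : {set {set T}}))); split=> //.
  by move=> F G; rewrite mem_enum => /facets_sub; rewrite inE.
- apply/shellableP; exists (enum (facets D)); split=> //.
  have /eqP/cards1P[K ->] := f1.
  by rewrite enum_set1 => F G; rewrite !inE => /eqP-> /eqP->; rewrite ltnn.
- apply: (shellable_shed cD shed); first exact/IHd/del_closed.
  exact/IHl/link_closed.
Qed.

Section Rearrangement.

Variable s : seq {set T}.
Hypotheses (as_ : antichain s) (sh : shelling s).

Definition larger_first F G :=
  (#|G| < #|F|) || (#|F| == #|G|) && (index F s <= index G s).

Lemma larger_first_total : total larger_first.
Proof.
move=> F G; rewrite /larger_first; case: ltngtP => //= _; exact: leq_total.
Qed.

Lemma larger_first_trans : transitive larger_first.
Proof.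
move=> G F H /orP[h1|/andP[/eqP h1 h2]] /orP[h3|/andP[/eqP h3 h4]];
  apply/orP; [left|left|left|right].
- exact: ltn_trans h3 h1.
- by rewrite -h3.
- by rewrite h1.
- by rewrite h1 h3 eqxx (leq_trans h2 h4).
Qed.

(** Otherwise [H] would be [F] minus one vertex, hence a face of [F].  This is
    why the witness of a shelling step survives sorting by size. *)
Lemma card_step F H v : F \in s -> H \in s ->
  F :\: H = [set v] -> H != F -> #|F| <= #|H|.
Proof.
move=> sF sH FH HF; rewrite leqNgt; apply/negP=> ltHF.
have := cardsID H F; rewrite FH cards1 addn1 => cF.
have FIH : F :&: H = H.
  by apply/eqP; rewrite eqEcard subsetIr -ltnS cF.
by move: HF; rewrite (as_ sH sF) ?eqxx // -FIH subsetIl.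
Qed.

(** The only pairs that sorting exchanges: [G] comes after [F] but is larger.
    A shelling step from [G] leads to an earlier facet [K] that is no smaller
    than [G] and differs from it by a vertex [w] outside [F]; a step from [F]
    against [K] is then also a step against [G]. *)
Lemma step_larger F G : F \in s -> G \in s ->
  index F s < index G s -> #|F| < #|G| -> shelling_step s F G.
Proof.
move=> sF; have [n] := ubnP (index G s); elim: n G => // n IH G.
rewrite ltnS => Gn sG FG cFG.
have [w [K [wGF sK KG GK]]] := sh sG sF FG.
have nKG : K != G by apply: contraTneq KG => ->; rewrite ltnn.
have /andP[wF wG] : (w \notin F) && (w \in G) by rewrite -in_setD.
have cGK := card_step sG sK GK nKG.
have lift : shelling_step s F K -> shelling_step s F G.
  move=> [v [H [vFK sH HF FH]]]; exists v, H; split=> //.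
  move: vFK; rewrite !inE => /andP[vK vF]; rewrite vF andbT.
  apply/negP=> vG; have : v \in G :\: K by rewrite inE vK.
  by rewrite GK inE => /eqP vw; rewrite -vw vF in wF.
apply: lift; case: (ltngtP (index K s) (index F s)) => [KF|FK|KF].
- exact: sh.
- by apply: IH => //; [apply: leq_trans KG Gn|apply: leq_trans cFG cGK].
- have KF' : K = F by apply: (index_inj F sK).
  by move: cFG; rewrite ltnNge -KF' cGK.
Qed.

(** The Bjorner-Wachs rearrangement. *)
Lemma shelling_sort : shelling (sort larger_first s).
Proof.
set t := sort _ s.
have st F : (F \in t) = (F \in s) by rewrite mem_sort.
have srt : sorted larger_first t by apply/sort_sorted/larger_first_total.
have lt_t F G : F \in s -> G \in s -> index G t < index F t -> larger_first G F.
  by move=> sF sG; apply: (sorted_ltn_index larger_first_trans srt); rewrite st.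
have t_lt F G : F \in s -> G \in s -> G != F -> larger_first G F ->
    index G t < index F t.
  move=> sF sG nGF GF; rewrite ltnNge leq_eqVlt; apply/negP=> /orP[/eqP E|h].
    by move: nGF; rewrite (index_inj F _ _ (esym E)) ?st ?eqxx.
  have := lt_t G F sG sF h; move: GF; rewrite /larger_first.
  case: ltngtP => //= _ h1 h2; have E : index F s = index G s.
    by apply/eqP; rewrite eqn_leq h1 h2.
  by move: nGF; rewrite (index_inj F sF sG E) ?eqxx.
move=> F G; rewrite !st => sF sG GF.
have nGF : G != F by apply: contraTneq GF => ->; rewrite ltnn.
suff [v [H [vFG sH HF FH]]] : shelling_step s F G.
  have nHF : H != F by apply: contraTneq HF => ->; rewrite ltnn.
  exists v, H; rewrite st; split=> //; apply: t_lt => //.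
  have := card_step sF sH FH nHF; rewrite /larger_first leq_eqVlt.
  by case/orP=> [/eqP->|->] //; rewrite eqxx (ltnW HF) orbT.
case: (ltngtP (index G s) (index F s)) => [|FG|E]; first exact: sh.
- apply: step_larger => //; move: (lt_t _ _ sF sG GF); rewrite /larger_first.
  by rewrite [_ <= index F s]leqNgt FG andbF orbF.
- by rewrite (index_inj F sG sF E) eqxx in nGF.
Qed.

End Rearrangement.

Lemma shellable_sorted D : shellable D ->
  exists s, [/\ perm_eq s (enum (facets D)),
               sorted (fun F G => #|G| <= #|F|) s & shelling s].
Proof.
move=> /shellableP[s [ps sh]]; exists (sort (larger_first s) s).
split; first by rewrite perm_sort.
- apply: (@sub_sorted _ (larger_first s)).
    by move=> F G /orP[/ltnW //|/andP[/eqP-> _]].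
  exact/sort_sorted/larger_first_total.
- exact: shelling_sort (facets_seq_antichain ps) sh.
Qed.

End Shellings.

(** * Leaf orders and colourings *)

Section LeafOrders.

Variable T : finType.
Implicit Types (F G : {set T}) (s : seq {set T}).

Lemma facets_complex_of s : antichain s ->
  facets (complex_of s) = [set F in s].
Proof.
move=> as_; apply/setP=> F; rewrite [in RHS]inE; apply/facetsP/idP.
- move=> [FD mF]; move: (FD); rewrite inE => /hasP[G sG FG].
  by rewrite -(mF G) // inE; apply/hasP; exists G.
- move=> sF; split; first by rewrite inE; apply/hasP; exists F.
  move=> G; rewrite inE => /hasP[H sH GH] FG.
  have FH := as_ _ _ sF sH (subset_trans FG GH).
  by apply/eqP; rewrite eqEsubset FG {1}FH GH.
Qed.

(** The quasi-forest condition, freed from the complexes spanned by prefixes. *)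
Definition leaf_order s :=
  forall i, 0 < i < size s -> exists2 M, M \in take i s &
    forall N, N \in take i s -> N :&: nth set0 s i \subset M.

Lemma leaf_order_of_leaves s : uniq s -> antichain s ->
  (forall i, i < size s -> leaf (complex_of (take i.+1 s)) (nth set0 s i)) ->
  leaf_order s.
Proof.
move=> us as_ lv i /andP[i0 si].
have [_] := lv i si; rewrite facets_complex_of; last first.
  by move=> F G /mem_take sF /mem_take sG; apply: as_.
rewrite (take_nth set0 si); set F := nth _ _ _ => lF.
have nF : F \notin take i s.
  have : uniq (take i.+1 s) by apply: take_uniq.
  by rewrite (take_nth set0 si) rcons_uniq => /andP[].
have [G sG] : exists G, G \in take i s.
  exists (nth set0 s 0); rewrite -(nth_take _ i0) mem_nth // size_take si.
  by [].
case: lF => [E|[M [sM MF maxM]]].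
  have : G \in [set F] by rewrite -E inE mem_rcons inE sG orbT.
  by rewrite inE => /eqP GF; rewrite -GF sG in nF.
exists M; first by move: sM; rewrite inE mem_rcons inE (negbTE MF).
move=> N sN; apply: subset_trans (subsetIl M F); apply: maxM.
  by rewrite inE mem_rcons inE sN orbT.
by apply: contraNneq nF => <-.
Qed.

(** If the facets through the edge [vw] contain no further vertex of [X], then
    within [X] deleting that edge disconnects [v] from [w].  The colour is
    extended one leaf [F] at a time: the vertices of [F] already coloured lie in
    one earlier facet [M], so at most one colour is prescribed on [F], or [M]
    contains both [v] and [w]. *)
Lemma leaf_order_coloring (v w : T) (X : {set T}) s :
  v != w ->
  (forall F, F \in s -> v \in F -> w \in F -> F :&: X \subset [set v; w]) ->
  leaf_order s ->
  exists c : T -> bool, forall F, F \in s ->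
    if (v \in F) && (w \in F) then is_true (c v != c w)
    else {in F :&: X &, forall a b, c a = c b}.
Proof.
move=> nvw; elim/last_ind: s => [|s F IH] smallX lo; first by exists xpredT.
have [||c cP] := IH.
- by move=> G sG; apply: smallX; rewrite mem_rcons inE sG orbT.
- move=> i /andP[i0 si]; have := lo i; rewrite size_rcons i0 (ltn_trans si) //.
  by rewrite -cats1 takel_cat ?(ltnW si) // nth_cat si; apply.
pose old u := has (fun N : {set T} => u \in N) s.
have [M oldM Ms] : exists2 M : {set T}, forall u, u \in F -> old u -> u \in M &
    (M \in s) \/ (forall u, ~~ old u).
  case: (posnP (size s)) => [/size0nil s0|s0].
    by exists set0; rewrite /old s0 //; right.
  have := lo (size s); rewrite size_rcons s0 ltnSn nth_rcons ltnn eqxx.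
  rewrite -cats1 take_size_cat // => -[//|M sM MP]; exists M; last by left.
  by move=> u uF /hasP[N sN uN]; apply: (subsetP (MP N sN)); rewrite inE uN.
have oldP u G : G \in s -> u \in G -> old u by move=> sG uG; apply/hasP; exists G.
suff [f fP] : exists f : T -> bool, let c' u := if old u then c u else f u in
    if (v \in F) && (w \in F) then is_true (c' v != c' w)
    else {in F :&: X &, forall a b, c' a = c' b}.
  exists (fun u => if old u then c u else f u) => G; rewrite mem_rcons inE.
  case/predU1P=> [->|sG]; first exact: fP.
  have := cP G sG; case: ifP => [/andP[vG wG]|_ mono a b].
    by rewrite (oldP v G) // (oldP w G).
  move=> /[dup] /setIP[aG _] aGX /[dup] /setIP[bG _] bGX.
  by rewrite (oldP a G) // (oldP b G) //; apply: mono.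
case: (boolP ((v \in F) && (w \in F))) => [/andP[vF wF]|nvwF].
(* vertices of [F] that are not [old] are free: give [v], [w] opposite colours *)
- exists (fun u => if old v then ~~ c v else if old w then ~~ c w else u == v).
  case ov: (old v); case ow: (old w); rewrite /= ?ov ?ow.
  + case: Ms => [sM|/(_ v)]; last by rewrite ov.
    by have := cP M sM; rewrite !oldM.
  + by case: (c v).
  + by case: (c w).
  + by rewrite eqxx [w == v]eq_sym (negbTE nvw).
- have mono a b : a \in F :&: X -> b \in F :&: X -> old a -> old b -> c a = c b.
    move=> aFX bFX oa ob.
    have [[aF aX] [bF bX]] := (setIP aFX, setIP bFX).
    case: Ms => [sM|/(_ a)]; last by rewrite oa.
    have [aM bM] : a \in M :&: X /\ b \in M :&: X by rewrite !inE !oldM.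
    have := cP M sM; case: ifP => [/andP[vM wM] _|_]; last exact.
    have sub := smallX M; rewrite mem_rcons inE sM orbT in sub.
    have {}sub := subsetP (sub isT vM wM).
    move: (sub _ aM) (sub _ bM) aF bF; rewrite !inE.
    by case/orP=> /eqP-> /orP[] /eqP-> // h1 h2; rewrite h1 h2 in nvwF.
  case: (pickP [pred u in F :&: X | old u]) => [u /andP[uFX ou]|none].
    exists (fun _ => c u) => c' a b aFX bFX /=; rewrite /c'.
    by case oa: (old a); case ob: (old b); rewrite ?(mono a u) ?(mono b u).
  exists (fun _ => true) => c' a b aFX bFX.
  by rewrite /c'; move: (none a) (none b); rewrite /= aFX bFX /= => -> ->.
Qed.

End LeafOrders.

Section Graphs.

Variables (T : finType) (e : rel T).
Hypotheses (e_sym : symmetric e) (e_irr : irreflexive e).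
Implicit Types (E F G A U : {set T}) (s t : seq {set T}) (u v w : T).

Local Notation h := (compl_rel e).
Local Notation D := (independence_complex e).

Lemma compl_sym : symmetric h.
Proof. by move=> u v; rewrite /compl_rel eq_sym e_sym. Qed.

Lemma complexP A : reflect {in A &, forall u v, u != v -> h u v} (A \in D).
Proof.
rewrite inE; apply: (iffP forall_inP) => [AP u v uA vA uv | cA u uA].
  by rewrite /compl_rel uv; apply: (forall_inP (AP u uA)).
apply/forall_inP=> v vA; case: (eqVneq u v) => [->|uv]; first by rewrite e_irr.
by have := cA u v uA vA uv; rewrite /compl_rel => /andP[].
Qed.

Lemma complex_closed : down_closed D.
Proof.
move=> E F /subsetP EF /complexP cF; apply/complexP=> u v uE vE.
by apply: cF; apply: EF.
Qed.

(** Flagness: [D] is determined by its edges. *)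
Lemma complex_setU1 v A : (v |: A \in D) =
  (A \in D) && [forall u in A, (u != v) ==> h v u].
Proof.
apply/complexP/andP => [c|[/complexP cA /forall_inP cv] a b].
  split; first by apply/complexP=> a b aA bA; apply: c; rewrite inE ?aA ?bA orbT.
  apply/forall_inP=> u uA; apply/implyP=> uv.
  by apply: c; rewrite ?inE ?eqxx ?uA ?orbT // eq_sym.
rewrite !inE => /predU1P[->|aA] /predU1P[->|bA]; rewrite ?eqxx //.
- by rewrite eq_sym; apply/implyP/cv.
- by rewrite compl_sym; apply/implyP/cv.
- exact: cA.
Qed.

(** * Trees are vertex decomposable quasi-forests *)

Definition restrict U := [set A in D | A \subset U].

Lemma restrict_closed U : down_closed (restrict U).
Proof.
move=> E F EF /setIdP[FD FU]; apply/setIdP; split.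
  exact: complex_closed EF FD.
exact: subset_trans FU.
Qed.

Lemma del_restrict U v : v \notin U -> del (restrict (v |: U)) v = restrict U.
Proof.
move=> vU; apply/setP=> A; apply/setIdP/setIdP => [[/setIdP[AD AU] vA]|[AD AU]].
  split=> //; apply/subsetP=> u uA; have := subsetP AU u uA; rewrite !inE.
  by case: eqP => // uv; rewrite -uv uA in vA.
split; first by apply/setIdP; split=> //; rewrite (subset_trans AU) ?subsetUr.
by apply: contra vU; apply: (subsetP AU).
Qed.

Lemma link_restrict (U C : {set T}) v : v \notin U -> C \subset U -> C \in D ->
  {in U, forall u, h v u = (u \in C)} ->
  link (restrict (v |: U)) v = powerset C.
Proof.
move=> vU CU DC hv; apply/setP=> A; rewrite powersetE.
have vA_U : A \subset U -> v \notin A 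
  by move/subsetP=> AU; apply: contra vU; apply: AU.
apply/setIdP/idP => [[vA /setIdP[]]|AC].
  rewrite complex_setU1 => /andP[_ /forall_inP hA].
  rewrite subUset => /andP[_ /subsetP AU]; apply/subsetP=> u uA.
  have uv : u != v by apply: contraNneq vA => <-.
  have := AU u uA; rewrite in_setU1 (negbTE uv) /= => uU.
  by rewrite -hv //; apply: implyP uv; apply: hA.
have AU := subset_trans AC CU.
split; first exact: vA_U.
apply/setIdP; split; last by rewrite setUS.
rewrite complex_setU1 (complex_closed AC DC); apply/forall_inP=> u uA.
by apply/implyP=> _; rewrite hv ?(subsetP AU) ?(subsetP AC).
Qed.

Lemma facets_powerset (C : {set T}) : facets (powerset C) = [set C].
Proof.
apply/setP=> F; rewrite in_set1; apply/facetsP/eqP => [[] |->].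
  by rewrite powersetE => FC /(_ C) ->; rewrite ?powersetE.
split; first by rewrite powersetE.
by move=> G; rewrite powersetE => GC CG; apply/eqP; rewrite eqEsubset GC.
Qed.

Lemma leaf_rcons s F M : antichain (rcons s F) -> uniq (rcons s F) ->
  M \in s -> {in s, forall N, N :&: F \subset M} ->
  leaf (complex_of (rcons s F)) F.
Proof.
move=> as_; rewrite rcons_uniq => /andP[nF us] sM MP.
rewrite /leaf facets_complex_of // inE mem_rcons mem_head; split=> //.
right; exists M; split; rewrite ?inE ?mem_rcons ?inE ?sM ?orbT //.
  by apply: contraNneq nF => <-.
move=> N; rewrite inE mem_rcons inE => /orP[->//|sN _].
by rewrite subsetI MP // subsetIr.
Qed.

(** As [#|C| = d.-1] and all earlier facets have at least [d] vertices, [C] is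
    not a facet; this gives both the shedding condition and the count of the
    facets. *)
Lemma tree_facets ds U : tree_steps h ds U -> sorted geq ds -> all (leq 1) ds ->
  vertex_decomposable (restrict U) /\
  exists s, [/\ perm_eq s (enum (facets (restrict U))),
    [seq #|F : {set T}| | F <- s] = ds &
    forall i, i < size s -> leaf (complex_of (take i.+1 s)) (nth set0 s i)].
Proof.
elim=> {ds U} [d U cU clU _ _|ds d U C v _ IH vU CU clC cC hv].
  have UD : U \in D by apply/complexP.
  have fU : facets (restrict U) = [set U].
    rewrite -facets_powerset; congr facets; apply/setP=> A; rewrite powersetE.
    apply/setIdP/idP => [[]//|AU]; split=> //; exact: complex_closed AU UD.
  split; first by apply: VD_simplex; rewrite fU cards1.
  exists [:: U]; rewrite fU enum_set1 /= cU; split=> // -[|//] _ /=.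
  have fU1 : facets (complex_of [:: U]) = [set U].
    rewrite facets_complex_of; last by move=> F G; rewrite !inE => /eqP-> /eqP->.
    by apply/setP=> F; rewrite !inE.
  by rewrite /leaf fU1 inE eqxx; split=> //; left.
have trg : transitive geq by move=> x y z xy yz; apply: leq_trans yz xy.
rewrite sorted_pairwise // pairwise_rcons -sorted_pairwise // all_rcons.
move=> /andP[ge_d sds] /andP[d1 ds1].
have {IH} [//|//|vdU [s [ps cs lv]]] := IH.
have CD : C \in D by apply/complexP.
have hvC : {in U, forall u, h v u = (u \in C)} by move=> u /hv[].
have dE := del_restrict vU; have lE := link_restrict vU CU CD hvC.
have large F : F \in facets (restrict U) -> d <= #|F|.
  rewrite -(mem_facets_seq _ ps) => sF; apply: (allP ge_d).
  by rewrite -cs map_f.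
have nC : C \notin facets (restrict U).
  by apply/negP=> /large; rewrite cC -ltnS prednK // ltnn.
have cl := @restrict_closed (v |: U).
have shed : {in facets (link (restrict (v |: U)) v),
    forall F, F \notin facets (del (restrict (v |: U)) v)}.
  by move=> F; rewrite lE dE facets_powerset inE => /eqP->.
have vC : v \notin C by apply: contra vU; apply: (subsetP CU).
have fE F : (F \in facets (restrict (v |: U))) =
    (F \in facets (restrict U)) || (F == v |: C).
  by rewrite (facets_shed cl shed) dE lE facets_powerset imset_set1 in_set1.
split.
  apply: (@VD_shed _ _ v) => //; last 1 first.
  - by rewrite lE; apply: VD_simplex; rewrite facets_powerset cards1.
  - apply/setIdP; split; last by rewrite sub1set setU11.
    by apply/complexP=> a b; rewrite !inE => /eqP-> /eqP->; rewrite eqxx.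
  - by rewrite dE.
have sF F : F \in s -> F \subset U.
  by rewrite (mem_facets_seq _ ps) => /facets_sub /setIdP[].
have nvC : v |: C \notin s.
  by apply: contra vU => /sF; rewrite subUset sub1set => /andP[].
have us : uniq s by rewrite (perm_uniq ps) enum_uniq.
have ps' : perm_eq (rcons s (v |: C)) (enum (facets (restrict (v |: U)))).
  apply: uniq_perm; rewrite ?enum_uniq ?rcons_uniq ?nvC // => F.
  by rewrite mem_enum fE mem_rcons inE orbC (mem_facets_seq _ ps).
exists (rcons s (v |: C)); split=> //.
  by rewrite map_rcons cs cardsU1 vC cC add1n prednK.
move=> i; rewrite size_rcons ltnS leq_eqVlt => /predU1P[->|si]; last first.
  by rewrite nth_rcons si -cats1 takel_cat //; apply: lv.
rewrite nth_rcons ltnn eqxx take_oversize ?size_rcons //.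
have CU' : C \in restrict U by apply/setIdP.
have [M fM CM] := sub_facet CU'.
apply: (leaf_rcons (M := M)).
- exact: facets_seq_antichain ps'.
- by rewrite rcons_uniq nvC.
- by rewrite (mem_facets_seq _ ps).
move=> N /sF /subsetP NU; apply: subset_trans CM; apply/subsetP=> u.
rewrite !inE => /andP[/NU uU] /predU1P[uv|//].
by rewrite uv (negbTE vU) in uU.
Qed.

(** * Sorted shellings of quasi-forests *)

Section SortedShelling.

Variables s t : seq {set T}.
Hypotheses (ps : perm_eq s (enum (facets D))) (los : leaf_order s).
Hypotheses (pt : perm_eq t (enum (facets D))) (sht : shelling t)
  (srt : sorted (fun F G => #|G| <= #|F|) t).

Lemma card_before F G : F \in t -> G \in t -> index G t < index F t ->
  #|F| <= #|G|.
Proof.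
have tr : transitive (fun F G : {set T} => #|G| <= #|F|).
  by move=> A B E /[swap]; apply: leq_trans.
by move=> tF tG; apply: (sorted_ltn_index tr srt).
Qed.

(** Connectedness in shelling order: a step between facets containing [E]
    removes a vertex outside [E], so it leads to an earlier facet which contains
    [E] and shares with the given one a further vertex. *)
Lemma constant_on_star (c : T -> bool) E F :
  F \in t -> #|E|.+1 < #|F| ->
  (forall G, G \in t -> index G t < index F t -> E \subset G ->
     {in G :\: E &, forall a b, c a = c b}) ->
  forall G H, G \in t -> H \in t -> index G t < index F t ->
    index H t < index F t -> E \subset G -> E \subset H ->
    forall a b, a \in G :\: E -> b \in H :\: E -> c a = c b.
Proof.
move=> tF cE mono.
suff: forall n G H, G \in t -> H \in t -> index G t < n -> n <= index F t ->
    index H t <= index G t -> E \subset G -> E \subset H ->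
    forall a b, a \in G :\: E -> b \in H :\: E -> c a = c b.
  move=> P G H tG tH GF HF EG EH a b aG bH.
  case: (leqP (index H t) (index G t)) => [HG|/ltnW GH].
    exact: (P (index F t) G H).
  by apply/esym; apply: (P (index F t) H G).
elim=> // n IH G H tG tH Gn nF HG EG EH a b aG bH.
have GF : index G t < index F t := leq_trans Gn nF.
case: (ltngtP (index H t) (index G t)) HG => // [HG _|HG _]; last first.
  have {}HG : H = G by apply: (index_inj H tH tG HG).
  by rewrite HG in bH; apply: (mono G).
have [x [K [xGH tK KG GK]]] := sht tG tH HG.
have xE : x \notin E by apply: contraL xGH => xE; rewrite inE (subsetP EH).
have GKx u : u \in G -> u != x -> u \in K.
  move=> uG; apply: contraNT => uK.
  by rewrite -in_set1 -GK inE uK.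
have EK : E \subset K.
  apply/subsetP=> u uE; apply: GKx; first exact: (subsetP EG).
  by apply: contraNneq xE => <-.
have [y yG yx] : exists2 y, y \in G :\: E & y != x.
  have : 1 < #|G :\: E|.
    rewrite cardsD (setIidPr EG) ltn_subRL addn1.
    exact: leq_trans cE (card_before tF tG GF).
  rewrite (cardsD1 x) => lt1.
  have /card_gt0P[y] : 0 < #|(G :\: E) :\ x|.
    by move: lt1; case: (x \in _); rewrite ?add1n ?add0n => // /ltnW.
  by rewrite in_setD1 => /andP[yx yG]; exists y.
have yK : y \in K :\: E.
  by move: yG; rewrite !inE => /andP[-> /GKx->].
rewrite (mono G tG GF EG a y aG yG).
have Kn : index K t < n by apply: leq_trans KG _; rewrite -ltnS.
have Hn : index H t < n by apply: leq_trans HG _; rewrite -ltnS.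
case: (leqP (index H t) (index K t)) => [HK|/ltnW KH].
  exact: (IH K H tK tH Kn (ltnW nF)).
by apply/esym; apply: (IH H K tH tK Hn (ltnW nF)).
Qed.

(** [X] consists of the vertices joined to all of [E := F :\: [set v; w]].  A
    vertex of [X] adjacent to both [v] and [w] would enlarge the facet [F]; so
    the colouring lemma applies and gives [v] and [w] different colours, as [F]
    contains both.  But [Hw], [Hv] contain [E] and precede [F], one contains [v]
    and the other [w], which makes the colours equal. *)
Lemma unique_step_vertex F v w Hv Hw : F \in t ->
  Hv \in t -> index Hv t < index F t -> F :\: Hv = [set v] ->
  Hw \in t -> index Hw t < index F t -> F :\: Hw = [set w] -> v = w.
Proof.
move=> tF tHv HvF FHv tHw HwF FHw; apply/eqP; apply: contraTT isT => nvw.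
have [vF vHv] : v \in F /\ v \notin Hv.
  by have := set11 v; rewrite -FHv inE => /andP[].
have [wF wHw] : w \in F /\ w \notin Hw.
  by have := set11 w; rewrite -FHw inE => /andP[].
have DF : F \in D by move: tF; rewrite (mem_facets_seq _ pt) => /facets_sub.
have maxF : forall G, G \in D -> F \subset G -> G = F.
  by move: tF; rewrite (mem_facets_seq _ pt) => /facetsP[].
have subD G : G \in t -> G \in D by rewrite (mem_facets_seq _ pt) => /facets_sub.
pose E := F :\: [set v; w].
have EF u : u \in F -> [|| u \in E, u == v | u == w].
  by move=> uF; rewrite !inE uF andbT orbC orbN.
pose X := [set u | (u \notin E) && (u |: E \in D)].
have small G : G \in s -> v \in G -> w \in G -> G :&: X \subset [set v; w].
  rewrite (mem_facets_seq _ ps) => /facets_sub GD vG wG; apply/subsetP=> u.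
  move=> /setIP[uG]; rewrite inE => /andP[uE uED].
  suff uF : u \in F by have := EF u uF; rewrite (negbTE uE) !inE.
  suff /maxF <- : u |: F \in D; rewrite ?setU11 ?subsetUr //.
  rewrite complex_setU1 DF; apply/forall_inP=> x xF; apply/implyP=> xu.
  move: uED; rewrite complex_setU1 => /andP[_ /forall_inP huE].
  have /complexP hG := GD.
  case/or3P: (EF x xF) => [xE|/eqP xv|/eqP xw].
  - exact: implyP (huE x xE) xu.
  - by apply: hG; rewrite ?xv // eq_sym -xv.
  - by apply: hG; rewrite ?xw // eq_sym -xw.
have [c cP] := leaf_order_coloring nvw small los.
have cP' G : G \in t -> G \in s.
  by rewrite (mem_facets_seq _ ps) (mem_facets_seq _ pt).
have mono G : G \in t -> index G t < index F t -> E \subset G ->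
    {in G :\: E &, forall a b, c a = c b}.
  move=> tG GF EG a b /setDP[aG aE] /setDP[bG bE].
  have := cP G (cP' _ tG); case: ifP => [/andP[vG wG] _|_].
    have FG : F \subset G.
      apply/subsetP=> u /EF /or3P[/(subsetP EG) //|/eqP->|/eqP->] //.
    by move: GF; rewrite (maxF _ (subD _ tG) FG) ltnn.
  have XG u : u \in G -> u \notin E -> u \in G :&: X.
    move=> uG uE; rewrite in_setI uG in_set uE; apply: complex_closed (subD G tG).
    by rewrite subUset sub1set uG.
  by apply; apply: XG.
have vw2 : v \in F :\ w by rewrite !inE nvw.
have cE : #|E|.+1 < #|F|.
  rewrite (cardsD1 w F) wF add1n ltnS (cardsD1 v (F :\ w)) vw2 add1n ltnS.
  rewrite leq_eqVlt; apply/orP; left; apply/eqP; apply: eq_card => u.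
  by rewrite !inE negb_or andbA.
have memH x H u : F :\: H = [set x] -> u \in F -> u != x -> u \in H.
  move=> FH uF; apply: contraNT => uH.
  by rewrite -in_set1 -FH inE uH.
have EHv : E \subset Hv.
  apply/subsetP=> u; rewrite !inE negb_or => /andP[/andP[uv _] uF].
  exact: memH FHv _ _.
have EHw : E \subset Hw.
  apply/subsetP=> u; rewrite !inE negb_or => /andP[/andP[_ uw] uF].
  exact: memH FHw _ _.
have := cP F (cP' _ tF); rewrite vF wF /= => /eqP[].
apply: (constant_on_star tF cE mono tHw tHv) => //.
  by rewrite !inE eqxx /= (memH _ _ v FHw).
by rewrite !inE eqxx orbT /= (memH _ _ w FHv) // eq_sym.
Qed.

Lemma fresh_vertex F : F \in t -> 0 < index F t ->
  exists x K, [/\ F :\: K = [set x], K \in t, index K t < index F t &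
    forall G, G \in t -> index G t < index F t -> x \notin G].
Proof.
move=> tF F0.
have t0 : 0 < size t by apply: ltn_trans F0 _; rewrite index_mem.
have ut : uniq t by rewrite (perm_uniq pt) enum_uniq.
have [|x [K [_ tK KF FK]]] := sht tF (mem_nth set0 t0).
  by rewrite index_uniq.
exists x, K; split=> // G tG GF.
have [y [H [yFG tH HF FH]]] := sht tF tG GF.
rewrite (unique_step_vertex tF tK KF FK tH HF FH).
by move: yFG; rewrite inE => /andP[].
Qed.

Definition vertices_before n :=
  [set u | has (fun F : {set T} => u \in F) (take n t)].

Lemma vertices_beforeP n u : reflect
  (exists F, [/\ F \in t, index F t < n & u \in F]) (u \in vertices_before n).
Proof.
rewrite inE; apply: (iffP hasP) => [[F sF uF]|[F [tF Fn uF]]].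
  by exists F; split=> //; [apply: mem_take sF|apply: index_ltn].
by exists F => //; rewrite in_take.
Qed.

(** The facet [F] in position [n] adds its fresh vertex [x], which is adjacent
    to no earlier vertex [u] outside [F]: a facet after [F] containing both [x]
    and [u] has a fresh vertex different from them, so some earlier facet
    contains both as well, and the first facet that does is [F]. *)
Lemma tree_of_sorted_shelling n : 0 < n <= size t ->
  tree_steps h [seq #|F : {set T}| | F <- take n t] (vertices_before n).
Proof.
have ut : uniq t by rewrite (perm_uniq pt) enum_uniq.
have subD G : G \in t -> G \in D by rewrite (mem_facets_seq _ pt) => /facets_sub.
case: n => // n /=; elim: n => [|n IH] nt.
  have -> : vertices_before 1 = nth set0 t 0.
    by apply/setP=> u; rewrite inE (take_nth set0 nt) take0 /= orbF.
  rewrite (take_nth set0 nt) take0 /=; apply: Tree_first => //.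
  exact/complexP/subD/mem_nth.
pose F := nth set0 t n.+1; have tF : F \in t by apply: mem_nth.
have iF : index F t = n.+1 by apply: index_uniq.
have [|x [K [FK tK KF nx]]] := @fresh_vertex F tF; first by rewrite iF.
have [xF xK] : x \in F /\ x \notin K.
  by have := set11 x; rewrite -FK inE => /andP[].
have CK : F :\ x \subset K.
  apply/subsetP=> u /setD1P[ux uF]; apply: contraNT ux => uK.
  by rewrite -in_set1 -FK inE uK.
have old_K : F :\ x \subset vertices_before n.+1.
  apply/subsetP=> u /(subsetP CK) uK; apply/vertices_beforeP.
  by exists K; rewrite -iF.
have xU : x \notin vertices_before n.+1.
  apply/vertices_beforeP=> -[G [tG Gn]]; apply/negP; apply: nx => //.
  by rewrite iF.
have -> : vertices_before n.+2 = x |: vertices_before n.+1.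
  apply/setP=> u; rewrite inE (take_nth set0 nt) has_rcons -/F !inE.
  case: (eqVneq u x) => [->|ux] /=; first by rewrite xF.
  apply/orb_idl => uF; have : u \in F :\ x by rewrite !inE ux.
  by move/(subsetP old_K); rewrite inE.
rewrite (take_nth set0 nt) map_rcons -/F.
have cF : {in F &, forall u v, u != v -> h u v} by apply/complexP/subD.
apply: (@Tree_glue _ _ _ _ _ (F :\ x)) => //.
- exact: IH (ltnW nt).
- by move=> u v /setD1P[_ uF] /setD1P[_ vF]; apply: cF.
- by rewrite (cardsD1 x F) xF.
move=> u uU; rewrite -(compl_sym x u); suff -> : h x u = (u \in F :\ x) by [].
have ux : u != x by apply: contraNneq xU => <-.
apply/idP/idP => [hxu|/setD1P[_ uF]]; last by apply: cF; rewrite // eq_sym.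
rewrite !inE ux /=.
have : [set x; u] \in D.
  apply/complexP=> a b; rewrite !inE.
  by case/orP=> /eqP-> /orP[]/eqP->; rewrite ?eqxx // compl_sym.
move/sub_facet => [G]; rewrite -(mem_facets_seq _ pt) subUset !sub1set.
move=> tG /andP[xG uG].
have [m] := ubnP (index G t); elim: m G tG xG uG => // m IHm G tG xG uG.
rewrite ltnS => Gm.
case: (ltngtP (index G t) (index F t)) => [GF|FG|GF]; last 1 first.
- by rewrite -(index_inj F tG tF GF).
- by rewrite (negbTE (nx G tG GF)) in xG.
have [|y [L [GL tL LG ny]]] := @fresh_vertex G tG; first exact: leq_ltn_trans FG.
have memL a : a \in G -> a != y -> a \in L.
  move=> aG; apply: contraNT => aL.
  by rewrite -in_set1 -GL inE aL.
apply: (IHm L) => //; last exact: leq_trans LG Gm.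
  by apply: memL => //; apply: contraTneq xF => ->; apply: ny.
apply: memL => //; have [N [tN Nn uN]] := vertices_beforeP _ _ uU.
apply: contraTneq uN => ->; apply: ny => //.
by apply: leq_trans Nn _; rewrite -iF ltnW.
Qed.

End SortedShelling.

Lemma restrictT : restrict [set: T] = D.
Proof. by apply/setP=> A; rewrite inE subsetT andbT. Qed.

Lemma tree_vd_quasi_forest ds : dtree h ds ->
  vertex_decomposable D /\ quasi_forest D.
Proof.
move=> [sds ds1 tds]; have := tree_facets tds sds ds1; rewrite restrictT.
by move=> [vdD [s [ps _ lv]]]; split=> //; exists s.
Qed.

Lemma shellable_quasi_forest_tree : 0 < #|T| ->
  shellable D -> quasi_forest D ->
  exists ds, size ds = #|facets D| /\ dtree h ds.
Proof.
move=> /card_gt0P[x0 _] /shellable_sorted[t [pt srt sht]] [s [ps lv]].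
have us : uniq s by rewrite (perm_uniq ps) enum_uniq.
have los := leaf_order_of_leaves us (facets_seq_antichain ps) lv.
have D1 x : [set x] \in D.
  by apply/complexP=> u v; rewrite !inE => /eqP-> /eqP->; rewrite eqxx.
have cover x : exists2 F, F \in t & x \in F.
  have [F fF xF] := sub_facet (D1 x); exists F; last by rewrite -sub1set.
  by rewrite (mem_facets_seq _ pt).
exists [seq #|F : {set T}| | F <- t]; split.
  by rewrite size_map (perm_size pt) -cardE.
split.
- by rewrite sorted_map.
- apply/allP=> _ /mapP[F tF ->]; rewrite card_gt0; apply/eqP=> F0.
  move: tF; rewrite (mem_facets_seq _ pt) => /facetsP[_ /(_ _ (D1 x0))].
  by rewrite F0 sub0set => /(_ isT) /setP /(_ x0); rewrite !inE eqxx.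
have -> : [set: T] = vertices_before t (size t).
  apply/setP=> x; rewrite inE; apply/esym/vertices_beforeP.
  by have [F tF xF] := cover x; exists F; rewrite index_mem.
rewrite -[X in map _ X]take_size; apply: (tree_of_sorted_shelling ps) => //.
rewrite leqnn andbT; have [F tF _] := cover x0.
by rewrite (leq_ltn_trans _ (_ : index F t < _)) ?index_mem.
Qed.

End Graphs.

(** * Face primes of the polynomial ring *)

Section FacePrimes.

Import GRing.Theory mpoly.
Local Open Scope ring_scope.

Variables (K : fieldType) (T : finType).
Local Notation S := {mpoly K[#|T|]}.
Implicit Types (E F R : {set T}) (p q x y : S) (m : 'X_{1..#|T|}).

Definition mnm_support m : {set T} := [set v | m (enum_rank v) != 0%N].

(** [restr F] sets the variables outside [F] to zero.  Describing [P_F] as its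
    kernel makes primality immediate. *)
Definition face_subst F : #|T|.-tuple S :=
  [tuple if enum_val i \in F then 'X_i else 0 | i < #|T|].

Definition restr F p : S := p \mPo face_subst F.

HB.instance Definition _ F :=
  GRing.LRMorphism.copy (restr F) (comp_mpoly (face_subst F)).

Lemma restrX F m :
  restr F 'X_[m] = if mnm_support m \subset F then 'X_[m] else 0.
Proof.
rewrite /restr comp_mpolyX; case: ifP => [/subsetP mF|/negbT].
  rewrite mpolyXE_id; apply: eq_bigr => i _; rewrite tnth_mktuple.
  case: ifP => // /negbT iF; suff -> : m i = 0%N by rewrite !expr0.
  by apply/eqP; apply: contraR iF => mi; apply: mF; rewrite inE enum_valK.
case/subsetPn=> v; rewrite inE => mv vF; rewrite (bigD1 (enum_rank v)) //=.
by rewrite tnth_mktuple enum_rankK (negbTE vF) expr0n (negbTE mv) mul0r.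
Qed.

Lemma mcoeff_restr F p m :
  (restr F p)@_m = if mnm_support m \subset F then p@_m else 0.
Proof.
rewrite {1}[p]mpolyE (raddf_sum (restr F)) raddf_sum /=.
under eq_bigr => k _ do rewrite linearZ /= restrX mcoeffZ.
have [mp|mp] := boolP (m \in msupp p); last first.
  rewrite (memN_msupp_eq0 mp) if_same big_seq big1 // => k kp.
  case: ifP => _; rewrite ?mcoeff0 ?mulr0 // mcoeffX.
  by case: eqP kp mp => [->->|]; rewrite ?mulr0.
rewrite (bigD1_seq m) //= big1 => [|k km].
  by case: ifP; rewrite ?mcoeffX ?eqxx ?mulr1 ?mcoeff0 ?mulr0 addr0.
by case: ifP => _; rewrite ?mcoeff0 ?mcoeffX ?(negbTE km) mulr0.
Qed.

Lemma restr_eq0P F p :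
  restr F p = 0 <-> (forall m, mnm_support m \subset F -> p@_m = 0).
Proof.
split=> [p0 m mF|p0].
  by have := mcoeff_restr F p m; rewrite p0 mcoeff0 mF.
by apply/mpolyP=> m; rewrite mcoeff_restr mcoeff0; case: ifP => // /p0.
Qed.

Lemma restr_id F p : restr F (restr F p) = restr F p.
Proof. by apply/mpolyP=> m; rewrite !mcoeff_restr; case: (_ \subset _). Qed.

Lemma restr_pihomog F p k :
  restr F p = 0 -> restr F (pihomog mdeg k p) = 0.
Proof.
move=> /restr_eq0P p0; apply/restr_eq0P=> m mF.
rewrite pihomogE raddf_sum /= big_seq_cond big1 // => j /andP[jp _].
rewrite mcoeffZ mcoeffX; case: eqP => [->|_]; last by rewrite mulr0.
by rewrite p0 ?mul0r.
Qed.

Definition set_mnm E : 'X_{1..#|T|} :=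
  [multinom (enum_val i \in E : nat) | i < #|T|].

Lemma vertex_monomialE E : vertex_monomial K E = 'X_[set_mnm E].
Proof.
rewrite /vertex_monomial mpolyXE_id (reindex_onto enum_rank enum_val) /=.
  rewrite big_mkcond /= [RHS]big_mkcond /=; apply: eq_bigr => v _.
  by rewrite mnmE enum_rankK eqxx; case: (v \in E).
by move=> i _; rewrite enum_valK.
Qed.

Lemma mnm_support_set_mnm E : mnm_support (set_mnm E) = E.
Proof. by apply/setP=> v; rewrite inE mnmE enum_rankK; case: (v \in E). Qed.

Lemma restr_monomial F E :
  restr F (vertex_monomial K E) = if E \subset F then vertex_monomial K E else 0.
Proof. by rewrite vertex_monomialE restrX mnm_support_set_mnm. Qed.

Lemma monomial_neq0 E : vertex_monomial K E != 0.
Proof.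
rewrite vertex_monomialE; apply/eqP=> /mpolyP /(_ (set_mnm E)).
by rewrite mcoeffX mcoeff0 eqxx => /eqP; rewrite oner_eq0.
Qed.

Lemma set_mnm_le E m : E \subset mnm_support m -> (set_mnm E <= m)%MM.
Proof.
move=> /subsetP Em; apply/mnm_lepP=> i; rewrite mnmE.
case: (boolP (enum_val i \in E)) => // iE.
have := Em _ iE; rewrite inE enum_valK lt0n.
by case: (m i).
Qed.

Lemma divisible_by_monomial E p :
  (forall m, p@_m != 0 -> E \subset mnm_support m) ->
  exists q, p = q * vertex_monomial K E.
Proof.
move=> Ep; exists (\sum_(m <- msupp p) p@_m *: 'X_[m - set_mnm E]).
rewrite {1}[p]mpolyE mulr_suml; apply: eq_big_seq => m.
rewrite mcoeff_msupp => /Ep /set_mnm_le mE.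
by rewrite vertex_monomialE -scalerAl -mpolyXD submK.
Qed.

Definition face_ideal F p := restr F p = 0.

Lemma face_ideal_ideal F : ideal (face_ideal F).
Proof.
split; rewrite /face_ideal; first exact: raddf0.
  by move=> x y x0 y0; rewrite raddfD /= x0 y0 addr0.
by move=> x y y0; rewrite rmorphM /= y0 mulr0.
Qed.

Lemma face_ideal_prime F : prime_ideal (face_ideal F).
Proof.
split; first exact: face_ideal_ideal.
  by rewrite /face_ideal rmorph1 => /eqP; rewrite oner_eq0.
move=> x y; rewrite /face_ideal rmorphM => /eqP; rewrite mulf_eq0.
by case/orP=> /eqP; [left|right].
Qed.

(** [P_(F :\ v)] is [P_F] plus the variable of [v]. *)
Lemma face_idealD1 F v p : v \in F -> face_ideal (F :\ v) p ->
  exists q, face_ideal F (p - q * vertex_monomial K [set v]).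
Proof.
move=> vF p0; have [m|q qE] := @divisible_by_monomial [set v] (restr F p).
  rewrite mcoeff_restr; case: ifP => [mF nz|_]; last by rewrite eqxx.
  rewrite sub1set; apply: contraNT nz => vm; apply/eqP.
  by move/restr_eq0P: p0; apply; rewrite subsetD1 mF.
by exists q; rewrite /face_ideal raddfB /= -qE restr_id subrr.
Qed.

End FacePrimes.

(** * Polynomial relations seen through their trailing terms *)

Section Trailing.

Import GRing.Theory mpoly.
Local Open Scope ring_scope.

Variable R : comUnitRingType.
Implicit Types (A B J : R -> Prop) (x y z : R) (xs : seq R).

Lemma ideal_subP J : ideal J -> forall x y, J x -> J y -> J (x - y).
Proof.
by case=> J0 JD JM x y Jx Jy; rewrite -mulN1r; apply: JD => //; apply: JM.
Qed.

Lemma ideal_shift J : ideal J -> forall x y, J (x - y) -> J y -> J x.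
Proof. by case=> J0 JD JM x y Jxy Jy; rewrite -(subrK y x); apply: JD. Qed.

Lemma choose_seq (Q : nat -> R -> Prop) n :
  (forall i, (i < n)%N -> exists x, Q i x) ->
  exists xs, size xs = n /\ forall i, (i < n)%N -> Q i (nth 0 xs i).
Proof.
elim: n => [|n IH] Qn; first by exists [::].
have [i /ltnW/Qn //|xs [sxs Qxs]] := IH; have [x Qx] := Qn n (ltnSn n).
exists (rcons xs x); rewrite size_rcons sxs; split=> // i.
rewrite ltnS leq_eqVlt nth_rcons sxs => /predU1P[->|ilt]; first by rewrite ltnn eqxx.
by rewrite ilt; apply: Qxs.
Qed.

Lemma krull_dim_unique A B c d : krull_dim A B c -> krull_dim A B d -> c = d.
Proof.
move=> [[P cP] maxc] [[Q cQ] maxd]; apply/eqP.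
by rewrite eqn_leq (maxd _ _ cP) (maxc _ _ cQ).
Qed.

(** [trailing xs y]: [y] is the value at [xs] of a polynomial whose coefficient
    at its lexicographically smallest monomial is a unit.  Only that monomial is
    kept; all other terms are absorbed into the arbitrary elements [r]. *)
Inductive trailing : seq R -> R -> Prop :=
| TrailingUnit c : c \is a GRing.unit -> trailing [::] c
| TrailingCons x xs q r (m : nat) :
    trailing xs q -> trailing (x :: xs) (x ^+ m * (q + x * r)).

Lemma trailing_mul xs y z : trailing xs y -> trailing xs z -> trailing xs (y * z).
Proof.
move=> ty; elim: ty z => {xs y} [c uc z tz|x xs q r m tq IH z tz].
  inversion_clear tz as [c' uc'|]; constructor.
  by rewrite unitrM uc.
inversion tz as [|x' xs' q' r' m' tq' E1 E2]; subst.
have -> : x ^+ m * (q + x * r) * (x ^+ m' * (q' + x * r')) =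
    x ^+ (m + m') * (q * q' + x * (q * r' + q' * r + x * r * r')).
  by rewrite exprD; ring.
by constructor; apply: IH.
Qed.

Lemma add_mul_ideal A B x : ideal A -> ideal B -> ideal (add_mul B x A).
Proof.
move=> [A0 AD AM] [B0 BD BM]; split.
- by exists 0, 0; rewrite mulr0 addr0.
- move=> _ _ [b [a [Bb Aa ->]]] [b' [a' [Bb' Aa' ->]]].
  exists (b + b'), (a + a'); split; [exact: BD|exact: AD|ring].
- move=> z _ [b [a [Bb Aa ->]]]; exists (z * b), (z * a).
  split; [exact: BM|exact: AM|ring].
Qed.

(** Cancelling the powers of the first element and reducing modulo it leaves a
    relation with the same trailing coefficient for the other elements; at the
    end a unit annihilates the last quotient, which is not zero. *)
Lemma regular_seq_trailing xs y A B : ideal A -> ideal B -> trailing xs y ->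
  (forall a, A a -> B (y * a)) -> regular_seq xs A B -> False.
Proof.
move=> iA iB ty; elim: ty B iB => {xs y} [c uc|x xs q r m tq IH] B iB yAB /=.
  case=> a [Aa []]; have [_ _ BM] := iB.
  by rewrite -[a](mulKr uc); apply: BM; apply: yAB.
move=> [regx regxs]; apply: IH regxs; first exact: add_mul_ideal.
move=> a Aa; have [_ _ AM] := iA.
have Bx k z : A z -> B (x ^+ k * z) -> B z.
  elim: k => [|k IHk] Az; first by rewrite mul1r.
  by rewrite exprS -mulrA => /regx Bz; apply: IHk => //; apply: Bz; apply: AM.
exists ((q + x * r) * a), (- r * a); split; last by ring.
  apply: (Bx m); first exact: AM.
  by rewrite mulrA; apply: yAB.
exact: AM.
Qed.

(** The same descent, with a prime in place of a regular element: the first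
    element can be cancelled modulo [P 0] and vanishes modulo [P 1]. *)
Lemma prime_chain_trailing xs y (P : nat -> R -> Prop) : trailing xs y ->
  (forall i, (i <= size xs)%N -> prime_ideal (P i)) ->
  (forall i, (i < size xs)%N -> forall z, P i z -> P i.+1 z) ->
  (forall i, (i < size xs)%N -> P i.+1 (nth 0 xs i) /\ ~ P i (nth 0 xs i)) ->
  ~ P 0%N y.
Proof.
move=> ty; elim: ty P => {xs y} [c uc|x xs q r m tq IH] P prP incP xP Py.
  have [[_ _ JM] n1 _] := prP 0%N isT; apply: n1.
  by rewrite -(mulVr uc); apply: JM.
have [iP0 _ P0M] := prP 0%N isT; have [/= Px nPx] := xP 0%N isT.
have {}Py : P 0%N (q + x * r).
  elim: m Py => [|m IHm]; first by rewrite mul1r.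
  by rewrite exprS -mulrA => /P0M[].
apply: (IH (fun i => P i.+1)) => [i|i|i|].
- exact: (prP i.+1).
- exact: (incP i.+1).
- exact: (xP i.+1).
have [iP1 _ _] := prP 1%N isT; have [_ _ JM] := iP1.
have := ideal_subP iP1 (incP 0%N isT _ Py) (JM r _ Px).
by rewrite [r * x]mulrC addrK.
Qed.

End Trailing.

Section Dependence.

Import GRing.Theory mpoly.
Local Open Scope ring_scope.

Variables (K : fieldType) (T : finType).
Local Notation S := {mpoly K[#|T|]}.
Implicit Types (F : {set T}) (p q x y : S) (m : 'X_{1..#|T|}) (xs : seq S).

Section Values.

Variable N : nat.

(** The value at [xs] of the polynomial with coefficients [u] and with all
    exponents less than [N], expanded variable by variable so that its trailing
    term can be read off by recursion. *)
Fixpoint value xs (u : seq nat -> K) : S :=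
  if xs is x :: xs' then
    \sum_(a < N) x ^+ a * value xs' (fun l => u (nat_of_ord a :: l))
  else (u [::])%:MP.

Definition nonzero_coef k (u : seq nat -> K) :=
  [exists t : k.-tuple 'I_N, u (map val t) != 0].

Lemma value_eq0 xs u : ~~ nonzero_coef (size xs) u -> value xs u = 0.
Proof.
elim: xs u => [|x xs IH] u /existsPn u0 /=.
  by have := u0 [tuple]; rewrite negbK /= => /eqP->; rewrite mpolyC0.
apply: big1 => a _; rewrite IH ?mulr0 //.
by apply/existsPn=> t; have := u0 [tuple of a :: t].
Qed.

(** Take the smallest exponent [a0] of the first variable that occurs. *)
Lemma trailing_value xs u : nonzero_coef (size xs) u -> trailing xs (value xs u).
Proof.
elim: xs u => [|x xs IH] u /existsP[t ut].
  rewrite tuple0 /= in ut; apply: TrailingUnit.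
  by apply/unitrP; exists ((u [::])^-1)%:MP; rewrite -!mpolyCM mulVf ?mulfV.
pose v a := value xs (fun l => u (a :: l)).
pose P a := (a < N)%N && nonzero_coef (size xs) (fun l => u (a :: l)).
have [a0 /andP[a0N nz0] mina0] : exists2 a0, P a0 & forall a, P a -> (a0 <= a)%N.
  have exP : exists a, P a.
    case/tupleP: t ut => a t ut; exists a; rewrite /P ltn_ord.
    by apply/existsP; exists t.
  by exists (ex_minn exP); case: ex_minnP.
have v0 a : (a < N)%N -> (a < a0)%N -> v a = 0.
  move=> aN aa0; apply: value_eq0; apply: contraL aa0 => nz.
  by rewrite -leqNgt mina0 // /P aN.
suff [r rE] : exists r, value (x :: xs) u = x ^+ a0 * (v a0 + x * r).
  by rewrite rE; apply: TrailingCons; apply: IH.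
exists (\sum_(a < N | (a0 < a)%N) x ^+ (a - a0.+1) * v a).
rewrite mulrDr /= (bigID (fun a : 'I_N => (a0 < a)%N)) /= addrC; congr (_ + _).
  rewrite (bigD1 (Ordinal a0N)) ?ltnn //= big1 ?addr0 // => a /andP[aa0 na].
  rewrite -/(v a) v0 ?mulr0 // ltn_neqAle leqNgt aa0 andbT.
  by apply: contra na => /eqP E; apply/eqP/val_inj.
rewrite mulrA -exprSr mulr_sumr; apply: eq_bigr => a a0a.
by rewrite mulrA -exprD subnKC.
Qed.

Lemma value_linear (I : finType) (w : I -> K) (f : I -> seq nat -> K) xs :
  value xs (fun l => \sum_i w i * f i l) = \sum_i w i *: value xs (f i).
Proof.
elim: xs f => [|x xs IH] f /=.
  rewrite raddf_sum; apply: eq_bigr => i _ /=.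
  by rewrite mpolyCM mul_mpolyC.
under eq_bigr => a _ do rewrite IH mulr_sumr.
rewrite exchange_big; apply: eq_bigr => i _ /=.
by rewrite scaler_sumr; apply: eq_bigr => a _; rewrite scalerAr.
Qed.

End Values.

Definition deg_le k p := forall m, (k < mdeg m)%N -> p@_m = 0.

Lemma deg_leM j k p q : deg_le j p -> deg_le k q -> deg_le (j + k) (p * q).
Proof.
move=> dp dq m jkm; apply/eqP; rewrite mcoeff_eq0; apply/negP=> /msuppM_le.
case/allpairsP=> -[m1 m2] /= [p1 q2 E]; move: jkm; rewrite E mdegD ltnNge leq_add //.
  rewrite leqNgt; apply: contraTN p1 => /dp.
  by rewrite mcoeff_msupp => ->; rewrite eqxx.
rewrite leqNgt; apply: contraTN q2 => /dq.
by rewrite mcoeff_msupp => ->; rewrite eqxx.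
Qed.

Lemma deg_leW j k p : (j <= k)%N -> deg_le j p -> deg_le k p.
Proof. by move=> jk dp m km; apply: dp; apply: leq_ltn_trans jk km. Qed.

Lemma deg_leX k p n : deg_le k p -> deg_le (n * k) (p ^+ n).
Proof.
move=> dp; elim: n => [|n IH]; last by rewrite exprS mulSn; apply: deg_leM.
by move=> m m0; rewrite expr0 mcoeff1; case: eqP m0 => // ->; rewrite mdeg0.
Qed.

Lemma deg_le_value N k xs u : (forall x, x \in xs -> deg_le k x) ->
  deg_le (size xs * (N * k)) (value N xs u).
Proof.
elim: xs u => [|x xs IH] u dxs /= m km.
  by rewrite mcoeffC; case: eqP km => [->|_ _]; rewrite ?mdeg0 ?mulr0.
rewrite raddf_sum /= big1 // => a _.
suff d : deg_le (N * k + size xs * (N * k))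
    (x ^+ a * value N xs (fun l => u (val a :: l))).
  by apply: d; rewrite -mulSn.
apply: deg_leM; last by apply: IH => z zxs; apply: dxs; rewrite inE zxs orbT.
apply: (@deg_leW (a * k)); first by rewrite leq_mul2r (ltnW (ltn_ord a)) orbT.
by apply: deg_leX; apply: dxs; rewrite mem_head.
Qed.

Lemma deg_le_bound xs : exists k, forall x, x \in xs -> deg_le k x.
Proof.
exists (\max_(x <- xs) msize x)%N => x xxs m km; apply/eqP.
rewrite mcoeff_eq0; apply: msize_mdeg_ge; apply: ltnW; apply: leq_ltn_trans km.
by rewrite (big_rem x) //= leq_maxl.
Qed.

(** With exponents less than [N], a polynomial in [k] variables has [N ^ k]
    coefficients, whereas its value, of degree at most [k * N * D], has modulo
    [P_F] at most [(k * N * D + 1) ^ #|F|] coefficients.  As [#|F| < k], the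
    first number is larger for large [N], and linear algebra produces a relation
    modulo [P_F]. *)
Lemma trailing_in_face_ideal F xs : (#|F| < size xs)%N ->
  exists2 y, trailing xs y & face_ideal F y.
Proof.
move=> Fk; set k := size xs; have [D degD] := deg_le_bound xs.
(* [M <= N * c], so [M ^ #|F| <= N ^ #|F| * c ^ #|F| < N ^ #|F|.+1]. *)
pose c := (k * D).+1; pose N := (c ^ #|F|).+1; pose M := (k * (N * D)).+1.
have MN : (M ^ #|F| < N ^ k)%N.
  have McN : (M <= N * c)%N by rewrite /M /c; nia.
  apply: leq_ltn_trans (_ : (N * c) ^ #|F| < _)%N.
    by case: (posnP #|F|) => [->//|F0]; rewrite leq_exp2r.
  rewrite expnMn; apply: (@leq_trans (N ^ #|F|.+1)); last by rewrite leq_pexp2l.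
  by rewrite expnSr ltn_pmul2l ?expn_gt0.
pose I := {: k.-tuple 'I_N}; pose J := pffun_on (ord0 : 'I_M) F 'I_M.
pose delta (t : k.-tuple 'I_N) l : K := (l == map val t)%:R.
pose expo (g : {ffun T -> 'I_M}) : 'X_{1..#|T|} :=
  [multinom g (enum_val i) : nat | i < #|T|].
pose A := \matrix_(i < #|I|, j < #|J|)
  (value N xs (delta (enum_val i)))@_(expo (enum_val j)).
have kerA : kermx A != 0.
  rewrite kermx_eq0; apply/negP=> /eqP rA; have := rank_leq_col A.
  by rewrite rA /I /J card_tuple card_pffun_on !card_ord leqNgt MN.
have [w /sub_kermxP wA /rV0Pn[i0 wi0]] := rowV0Pn kerA.
pose u l := \sum_(t : k.-tuple 'I_N) w 0 (enum_rank t) * delta t l.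
exists (value N xs u).
  apply: trailing_value; apply/existsP; exists (enum_val i0).
  rewrite /u (bigD1 (enum_val i0)) //= big1 => [|t ti0].
    by rewrite enum_valK /delta eqxx mulr1 addr0.
  rewrite /delta; case: eqP => [/(inj_map val_inj) E|]; last by rewrite mulr0.
  by case/eqP: ti0; apply/esym/val_inj.
apply/restr_eq0P=> m mF; case: (ltnP (k * (N * D)) (mdeg m)) => [|mle].
  exact: deg_le_value.
rewrite value_linear raddf_sum /=.
have mM i : (m i < M)%N.
  by rewrite ltnS (leq_trans _ mle) // mdegE (bigD1 i) //= leq_addr.
pose g := [ffun v => inord (m (enum_rank v)) : 'I_M].
have gJ : g \in J.
  apply/pffun_onP; split=> //; apply/supportP=> v vF.
  rewrite ffunE; apply/val_inj; rewrite /= inordK //.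
  by apply/eqP; apply: contraNT vF => mv; rewrite (subsetP mF) // inE.
have eg : expo g = m by apply/mnmP=> i; rewrite mnmE ffunE enum_valK inordK.
have /matrixP /(_ 0 (enum_rank_in gJ g)) := wA; rewrite !mxE.
rewrite (reindex_onto (@enum_rank _) enum_val) /=; last first.
  by move=> i _; rewrite enum_valK.
move=> E; rewrite -[RHS]E; apply: eq_big => [t|t _].
  by rewrite enum_rankK eqxx.
by rewrite mcoeffZ mxE enum_rankK enum_rankK_in // eg.
Qed.

End Dependence.

(** * Modules filtered by face rings of one dimension *)

Section Pure.

Import GRing.Theory mpoly.
Local Open Scope ring_scope.

Variables (K : fieldType) (T : finType).
Local Notation S := {mpoly K[#|T|]}.
Implicit Types (E F G : {set T}) (A B C J : S -> Prop) (a p q x y z : S).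

Definition add_cyclic B a : S -> Prop := fun x => exists s, B (x - s * a).

(** [A / B] is an iterated extension of modules isomorphic to [S / P_F] with
    [#|F| = d]. *)
Inductive pure_filtered (d : nat) : (S -> Prop) -> (S -> Prop) -> Prop :=
| PureCyclic A B a F of #|F| = d & ideal B &
    (forall x, A x <-> add_cyclic B a x) &
    (forall y, B (y * a) <-> face_ideal F y) : pure_filtered d A B
| PureExtension A B C of pure_filtered d A B & pure_filtered d B C :
    pure_filtered d A C.

Lemma add_cyclic_ideal B a : ideal B -> ideal (add_cyclic B a).
Proof.
move=> iB; have [B0 BD BM] := iB; split.
- by exists 0; rewrite mul0r subr0.
- move=> x y [s Bx] [t By]; exists (s + t).
  by have := BD _ _ Bx By; congr B; ring.
- move=> x y [s By]; exists (x * s).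
  by have := BM x _ By; congr B; ring.
Qed.

Lemma ideal_eqv A B : (forall x, A x <-> B x) -> ideal B -> ideal A.
Proof.
move=> AB [B0 BD BM]; split; first exact/AB.
  by move=> x y /AB Ax /AB Ay; apply/AB/BD.
by move=> x y /AB Ay; apply/AB/BM.
Qed.

Lemma pure_filtered_ideals d A B : pure_filtered d A B ->
  [/\ ideal A, ideal B & forall x, B x -> A x].
Proof.
elim=> {A B} [A B a F _ iB AE _|A B C _ [iA iB BA] _ [_ iC CB]].
  split=> //; first exact/(ideal_eqv AE)/add_cyclic_ideal.
  by move=> x Bx; apply/AE; exists 0; rewrite mul0r subr0.
by split=> // x /CB/BA.
Qed.

Lemma pure_filtered_eqv d A B A' B' : pure_filtered d A B ->
  (forall x, A x <-> A' x) -> (forall x, B x <-> B' x) -> pure_filtered d A' B'.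
Proof.
move=> pf.
elim: pf A' B' => {A B} [A B a F cF iB AE BE|A B C _ IH1 _ IH2] A' B' AA BB.
  apply: (PureCyclic (a := a) cF).
  - by apply: ideal_eqv iB => x; rewrite BB.
  - move=> x; rewrite -AA AE; split=> -[s Bx]; exists s; exact/BB.
  - by move=> y; rewrite -BB.
by apply: (@PureExtension _ _ B); [apply: IH1|apply: IH2].
Qed.

Lemma pure_filtered_bottom d A B : pure_filtered d A B ->
  exists a F, [/\ #|F| = d, A a & forall y, B (y * a) <-> face_ideal F y].
Proof.
elim=> {A B} [A B a F cF iB AE BE|A B C pfAB _ _ [a [F [cF Ba CE]]]].
  exists a, F; split=> //; apply/AE; exists 1; rewrite mul1r subrr; by case: iB.
have [_ _ BA] := pure_filtered_ideals pfAB.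
by exists a, F; split=> //; apply: BA.
Qed.

Lemma pure_filtered_proper d A B : pure_filtered d A B -> exists a, A a /\ ~ B a.
Proof.
move=> /pure_filtered_bottom[a [F [_ Aa BE]]]; exists a; split=> // Ba.
have [_ n1 _] := face_ideal_prime K F; apply: n1; apply/BE; by rewrite mul1r.
Qed.

Definition sum_ideal A J : S -> Prop :=
  fun x => exists y z, [/\ A y, J z & x = y + z].

Lemma sum_ideal_ideal A J : ideal A -> ideal J -> ideal (sum_ideal A J).
Proof.
move=> [A0 AD AM] [J0 JD JM]; split.
- by exists 0, 0; rewrite addr0.
- move=> _ _ [y [z [Ay Jz ->]]] [y' [z' [Ay' Jz' ->]]].
  exists (y + y'), (z + z'); split; [exact: AD|exact: JD|ring].
- move=> x _ [y [z [Ay Jz ->]]]; exists (x * y), (x * z).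
  split; [exact: AM|exact: JM|ring].
Qed.

(** The isomorphism of [(A + J) / (B + J)] with [A / B] when [A] meets [J]
    inside [B]. *)
Lemma pure_filtered_sum d A B J : ideal J -> (forall x, A x -> J x -> B x) ->
  pure_filtered d A B -> pure_filtered d (sum_ideal A J) (sum_ideal B J).
Proof.
move=> iJ AJ pf; have [J0 JD JM] := iJ; elim: pf AJ => {A B}.
  move=> A B a F cF iB AE BE AJ; have [B0 BD BM] := iB.
  have iA := ideal_eqv AE (add_cyclic_ideal a iB); have [A0 AD AM] := iA.
  have Aa : A a by apply/AE; exists 1; rewrite mul1r subrr.
  have BA x : B x -> A x by move=> Bx; apply/AE; exists 0; rewrite mul0r subr0.
  apply: (PureCyclic (a := a) cF); first exact: sum_ideal_ideal.
  - move=> x; split=> [[y [z [/AE[s By] Jz ->]]]|[s [y [z [By Jz E]]]]].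
      exists s, (y - s * a), z; split=> //; ring.
    exists (y + s * a), z; split=> //; first exact: AD (BA _ By) (AM _ _ Aa).
    by rewrite -(subrK (s * a) x) E; ring.
  - move=> y; split=> [[b [z [Bb Jz E]]]|/BE Bya]; last first.
      by exists (y * a), 0; rewrite addr0.
    apply/BE; rewrite E; apply: BD => //; apply: AJ => //.
    have -> : z = y * a - b by rewrite E; ring.
    by apply: ideal_subP => //; [apply: AM|apply: BA].
move=> A B C pfAB IH1 pfBC IH2 AJ; apply: PureExtension (IH1 _) (IH2 _).
  move=> x Ax Jx; have [_ _ CB] := pure_filtered_ideals pfBC.
  by apply: CB; apply: AJ.
by move=> x Bx Jx; have [_ _ BA] := pure_filtered_ideals pfAB; apply: AJ; auto.
Qed.

(** * A universal regular sequence *)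

Definition elem_sym (k : nat) : S :=
  \sum_(E : {set T} | #|E| == k) vertex_monomial K E.

Lemma restr_elem_sym F : restr F (elem_sym #|F|) = vertex_monomial K F.
Proof.
rewrite raddf_sum (bigD1 F) //= restr_monomial subxx big1 ?addr0 // => E.
move=> /andP[/eqP cE EF]; rewrite restr_monomial; case: ifP => // sEF.
by case/eqP: EF; apply/eqP; rewrite eqEcard sEF cE leqnn.
Qed.

(** On [S / P_F] the polynomial acts as the monomial of [F], which is not in the
    prime [P_F]. *)
Lemma elem_sym_regular d A B : pure_filtered d A B ->
  forall x, A x -> B (elem_sym d * x) -> B x.
Proof.
elim=> {A B} [A B a F cF iB AE BE|A B C pfAB IH1 pfBC IH2] x Ax.
  have /AE[s Bx] := Ax; move=> Bex; apply: (ideal_shift iB Bx); apply/BE.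
  have [_ _ prF] := face_ideal_prime K F; have [_ _ BM] := iB.
  have : B (elem_sym d * s * a).
    by have := ideal_subP iB Bex (BM (elem_sym d) _ Bx); congr B; ring.
  move/BE/prF=> [|//]; rewrite /face_ideal -cF restr_elem_sym => /eqP.
  by rewrite (negbTE (monomial_neq0 _ _)).
move=> Cex; have [_ _ CB] := pure_filtered_ideals pfBC.
by apply: IH2 => //; apply: IH1 => //; apply: CB.
Qed.

Lemma vertex_monomial0 : vertex_monomial K (set0 : {set T}) = 1.
Proof. by rewrite /vertex_monomial big_set0. Qed.

Lemma vertex_monomialU1 v E : v \notin E ->
  vertex_monomial K (v |: E) = vertex_monomial K [set v] * vertex_monomial K E.
Proof. by move=> vE; rewrite /vertex_monomial big_setU1 //= big_set1. Qed.

Lemma face_ideal_monomial F E :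
  face_ideal F (vertex_monomial K E) <-> ~~ (E \subset F).
Proof.
rewrite /face_ideal restr_monomial; case: ifP => //= _; split=> // /eqP.
by rewrite (negbTE (monomial_neq0 _ _)).
Qed.

Lemma face_ideal_sub F G x : F \subset G -> face_ideal G x -> face_ideal F x.
Proof.
move=> FG /restr_eq0P x0; apply/restr_eq0P=> m mF.
by apply: x0; apply: subset_trans mF FG.
Qed.

(** In [S / P_F], the quotient of the ideal generated by the monomial of [E] by
    the one generated by the monomial of [v |: E] is [S / P_(F :\ v)]. *)
Lemma pure_cyclic_step d B a F E v : #|F| = d.+1 -> ideal B ->
  (forall y, B (y * a) <-> face_ideal F y) ->
  v \in F -> v \notin E -> E \subset F ->
  pure_filtered d (add_cyclic B (vertex_monomial K E * a))
                  (add_cyclic B (vertex_monomial K (v |: E) * a)).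
Proof.
move=> cF iB BE vF vE EF; have [B0 BD BM] := iB.
rewrite vertex_monomialU1 //; set xv := vertex_monomial K [set v].
set xE := vertex_monomial K E.
have [_ _ prF] := face_ideal_prime K F.
have nE : ~ face_ideal F xE by rewrite face_ideal_monomial EF.
apply: (@PureCyclic _ _ _ (xE * a) (F :\ v)).
- by move: cF; rewrite (cardsD1 v) vF => -[].
- exact: add_cyclic_ideal.
- move=> x; split=> [[s Bx]|[s [t Bx]]].
    by exists s, 0; move: Bx; congr B; ring.
  by exists (s + t * xv); move: Bx; congr B; ring.
- move=> y; split=> [[s]|/face_idealD1 [//|s Fys]]; last first.
    exists s; have /BE : face_ideal F ((y - s * xv) * xE).
      by have [_ _ FM] := face_ideal_ideal K F; rewrite mulrC; apply: FM.
    by congr B; ring.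
  have -> : y * (xE * a) - s * (xv * xE * a) = (y - s * xv) * xE * a by ring.
  move/BE/prF=> [Fys|/nE//]; apply: (ideal_shift (face_ideal_ideal K _)).
    exact: face_ideal_sub (subsetDl _ _) Fys.
  have [_ _ FM] := face_ideal_ideal K (F :\ v); apply: FM.
  by apply/face_ideal_monomial; rewrite sub1set !inE eqxx.
Qed.

Lemma pure_cyclic_steps d B a F E : #|F| = d.+1 -> ideal B ->
  (forall y, B (y * a) <-> face_ideal F y) ->
  E \subset F -> E != set0 ->
  pure_filtered d (add_cyclic B a) (add_cyclic B (vertex_monomial K E * a)).
Proof.
move=> cF iB BE; have [n] := ubnP #|E|; elim: n E => // n IH E.
rewrite ltnS => En EF /set0Pn[v vE]; have vF := subsetP EF v vE.
have := @pure_cyclic_step d B a F (E :\ v) v cF iB BE vF.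
rewrite setD11 setD1K // => /(_ isT (subset_trans (subsetDl _ _) EF)).
case: (eqVneq (E :\ v) set0) => [->|nE]; first by rewrite vertex_monomial0 mul1r.
apply: PureExtension; apply: IH => //; last exact: subset_trans (subsetDl _ _) EF.
by move: En; rewrite (cardsD1 v) vE.
Qed.

Lemma multiples_ideal A x : ideal A ->
  ideal (fun y => exists2 a, A a & y = x * a).
Proof.
move=> [A0 AD AM]; split; first by exists 0; rewrite ?mulr0.
  by move=> _ _ [a Aa ->] [b Ab ->]; exists (a + b); [apply: AD|ring].
by move=> y _ [a Aa ->]; exists (y * a); [apply: AM|ring].
Qed.

(** In the cyclic case this is the filtration of [S / (P_F + x^F)] obtained by
    multiplying the variables of [F] one after the other.  It passes to
    extensions because [e] is regular: [B] meets [e A] in [e B]. *)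
Lemma pure_quotient d A B : pure_filtered d.+1 A B ->
  pure_filtered d A (add_mul B (elem_sym d.+1) A).
Proof.
set e := elem_sym _; elim=> {A B} [A B a F cF iB AE BE|A B C pfAB IH1 pfBC IH2].
  have nF : F != set0 by rewrite -card_gt0 cF.
  have [B0 BD BM] := iB.
  have := pure_cyclic_steps cF iB BE (subxx F) nF; move/pure_filtered_eqv; apply.
    by move=> x; rewrite AE.
  have eF : face_ideal F (e - vertex_monomial K F).
    rewrite /face_ideal raddfB /= /e -cF restr_elem_sym.
    by rewrite restr_monomial subxx subrr.
  have /BE eFa := eF.
  move=> x; split=> [[s Bx]|[b [c [Bb /AE[s Bc] ->]]]].
    exists (x - s * (e * a)), (s * a); split; last by ring.
      have := ideal_subP iB Bx (BM s _ eFa); congr B; ring.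
    by apply/AE; exists s; rewrite subrr.
  exists s; have := BD _ _ (BD _ _ Bb (BM e _ Bc)) (BM s _ eFa).
  by congr B; ring.
have [iA iB BA] := pure_filtered_ideals pfAB.
have [_ iC CB] := pure_filtered_ideals pfBC.
have [A0 AD _] := iA; have [B0 _ _] := iB; have [C0 _ _] := iC.
apply: (@PureExtension _ _ (add_mul B e A) _ IH1).
apply: (pure_filtered_eqv (pure_filtered_sum (multiples_ideal e iA) _ IH2)).
- move=> x Bx [c Ac xE]; exists 0, c; rewrite add0r; split=> //.
  by apply: (elem_sym_regular pfAB Ac); rewrite -/e -xE.
- move=> x; split=> [[b [_ [Bb [c Ac ->] ->]]]|[b [c [Bb Ac ->]]]].
    by exists b, c.
  by exists b, (e * c); split=> //; exists c.
- move=> x; split=> [[_ [_ [[b [c [Cb Bc ->]]] [c' Ac' ->] ->]]]|[b [c [Cb Ac ->]]]].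
    by exists b, (c + c'); split=> //; [apply: AD => //; apply: BA|ring].
  exists b, (e * c); split=> //; last by exists c.
  by exists b, 0; rewrite mulr0 addr0.
Qed.

Fixpoint elem_syms d := if d is d'.+1 then elem_sym d :: elem_syms d' else [::].

Lemma size_elem_syms d : size (elem_syms d) = d.
Proof. by elim: d => //= d ->. Qed.

Lemma elem_syms_regular d A B : pure_filtered d A B -> regular_seq (elem_syms d) A B.
Proof.
elim: d A B => [|d IH] A B pf /=; first exact: pure_filtered_proper pf.
split; first exact: elem_sym_regular pf.
exact/IH/pure_quotient.
Qed.

Lemma elem_sym_irrelevant k : (0 < k)%N -> irrelevant_ideal (elem_sym k).
Proof.
move=> k0 J iJ JX; have [J0 JD JM] := iJ; rewrite /elem_sym.
apply: big_ind => // E /eqP cE.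
have /card_gt0P[v vE] : (0 < #|E|)%N by rewrite cE.
rewrite /vertex_monomial (big_setD1 v) //= mulrC; apply: JM.
by apply: JX; exists (enum_rank v).
Qed.

Lemma elem_syms_irrelevant d : {in elem_syms d, forall x, irrelevant_ideal x}.
Proof.
elim: d => //= d IH x; rewrite inE => /predU1P[->|/IH//].
exact: elem_sym_irrelevant.
Qed.

(** A product of relations, one for each cyclic piece. *)
Lemma pure_annihilator d A B xs : pure_filtered d A B -> (d < size xs)%N ->
  exists2 y, trailing xs y & forall a, A a -> B (y * a).
Proof.
move=> pf dxs.
elim: pf => {A B} [A B a F cF iB AE BE|A B C _ [y ty yAB] _ [z tz zBC]].
  rewrite -cF in dxs; have [y ty Fy] := trailing_in_face_ideal dxs.
  exists y => // b /AE[s Bb]; apply: (ideal_shift iB (y := s * (y * a))).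
    have [_ _ BM] := iB; have := BM y _ Bb; congr B; ring.
  by have [_ _ BM] := iB; apply: BM; apply/BE.
exists (z * y); first exact: trailing_mul.
by move=> a Aa; rewrite -mulrA; apply: zBC; apply: yAB.
Qed.

(** The lower bound uses a submodule [S / P_F] of [A / B]: the annihilator of
    [A / B] lies in [P_F], below the primes of the faces of [F]. *)
Lemma pure_krull_dim d A B : pure_filtered d A B -> krull_dim A B d.
Proof.
move=> pf; split=> [|d' P [prP incP]].
  have [a [F [cF Aa BE]]] := pure_filtered_bottom pf.
  pose G i := [set v in drop i (enum F)].
  have GS i : G i.+1 \subset G i.
    by apply/subsetP=> v; rewrite !inE -addn1 addnC -drop_drop => /mem_drop.
  have GF i : G i \subset F.
    by apply/subsetP=> v; rewrite inE => /mem_drop; rewrite mem_enum.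
  exists (fun i => face_ideal (G i)); split=> i id.
    split=> [|x ax]; first exact: face_ideal_prime.
    by apply: (face_ideal_sub (GF i)); apply/BE/ax.
  split=> [x|]; first exact: face_ideal_sub.
  have sF : (i < size (enum F))%N by rewrite -cardE cF.
  have [v0 _] : exists v0, v0 \in F by apply/card_gt0P; rewrite cF (leq_trans _ id).
  exists (vertex_monomial K [set nth v0 (enum F) i]).
  rewrite !face_ideal_monomial !sub1set !inE; split.
    have := drop_uniq i (enum_uniq F).
    by rewrite (drop_nth v0 sF) cons_uniq => /andP[].
  by rewrite (drop_nth v0 sF) mem_head.
rewrite leqNgt; apply/negP=> dd'.
have [i id'|xs [sxs xsP]] :=
  @choose_seq _ (fun i x => P i.+1 x /\ ~ P i x) d'; first by have [] := incP i id'.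
have [|y ty yAB] := @pure_annihilator d A B xs pf; first by rewrite sxs.
have [_ annP] := prP 0%N isT.
apply: (prime_chain_trailing ty (P := P)); rewrite ?sxs; last exact: annP.
- by move=> i /prP[].
- by move=> i /incP[].
- exact: xsP.
Qed.

Lemma pure_cohen_macaulay d A B : pure_filtered d A B ->
  cohen_macaulay (@irrelevant_ideal K T) A B.
Proof.
move=> pf; exists d; split; first exact: pure_krull_dim.
split=> [|xs _ rxs].
  exists (elem_syms d); split; first exact: size_elem_syms.
    exact: elem_syms_irrelevant.
  exact: elem_syms_regular.
rewrite leqNgt; apply/negP=> /(pure_annihilator pf)[y ty yAB].
have [iA iB _] := pure_filtered_ideals pf.
exact: regular_seq_trailing iA iB ty yAB rxs.
Qed.

End Pure.

(** * The dimension filtration of a Stanley-Reisner ring *)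

Section ShellingFiltration.

Import GRing.Theory mpoly.
Local Open Scope ring_scope.

Variables (K : fieldType) (T : finType).
Local Notation S := {mpoly K[#|T|]}.
Implicit Types (E F G H R : {set T}) (p q x y : S).

Definition vanishing (Q : {set T} -> Prop) p := forall F, Q F -> face_ideal F p.

Lemma vanishing_ideal Q : ideal (vanishing Q).
Proof.
split=> [F _|x y x0 y0 F QF|x y y0 F QF]; have [J0 JD JM] := face_ideal_ideal K F.
- exact: J0.
- by apply: JD; [apply: x0|apply: y0].
- by apply: JM; apply: y0.
Qed.

Lemma vanishing_graded Q : graded_ideal (vanishing Q).
Proof.
split=> [|p k p0 F QF]; first exact: vanishing_ideal.
by apply: restr_pihomog; apply: p0.
Qed.

(** A polynomial vanishing on every facet is a combination of monomials whose
    support is not a face. *)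
Lemma stanley_reisner_facets (D : {set {set T}}) p : down_closed D ->
  stanley_reisner_ideal D p <-> vanishing (fun F => F \in facets D) p.
Proof.
move=> cD; split=> [|p0 J [J0 JD JM] JE].
  apply; first exact: vanishing_ideal.
  move=> _ [E ED ->] F /facets_sub DF; apply/face_ideal_monomial.
  by apply: contra ED => EF; apply: cD EF DF.
rewrite [p]mpolyE big_seq; apply: big_ind => // m; rewrite mcoeff_msupp => pm.
have mD : mnm_support m \notin D.
  apply: contra pm => /sub_facet[F fF mF]; apply/eqP.
  by have /restr_eq0P := p0 F fF; apply.
have [k|q ->] := @divisible_by_monomial K T (mnm_support m) 'X_[m].
  by rewrite mcoeffX; case: (eqVneq m k) => [->|]; rewrite ?subxx ?eqxx.
rewrite scalerAl; apply: JM; apply: JE.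
by exists (mnm_support m).
Qed.

Variable s : seq {set T}.
Hypotheses (us : uniq s) (shs : shelling s).

Definition prefix_ideal k := vanishing (fun F => F \in s /\ (index F s < k)%N).

(** The generator is the monomial of the restriction [R] of the facet [F].  Each
    earlier facet misses a vertex of [R], so the monomial vanishes there; and a
    polynomial vanishing on the earlier facets is, modulo [P_F], divisible by
    it, because for [v] in [R] some earlier facet contains [F :\ v]. *)
Lemma pure_shelling_step k : (k < size s)%N ->
  pure_filtered #|nth set0 s k| (prefix_ideal k) (prefix_ideal k.+1).
Proof.
move=> ks; set F := nth set0 s k.
have sF : F \in s by apply: mem_nth.
have iF : index F s = k by apply: index_uniq.
pose R := [set v in F |
  [exists H, [&& H \in s, (index H s < k)%N & F :\: H == [set v]]]].
have RF : R \subset F by apply/subsetP=> v; rewrite inE => /andP[].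
pose a := vertex_monomial K R.
have iB := vanishing_ideal (fun F => F \in s /\ (index F s < k.+1)%N).
have [FD0 FDD FDM] := face_ideal_ideal K F.
have splitB x : prefix_ideal k x -> face_ideal F x -> prefix_ideal k.+1 x.
  move=> xk xF G [sG]; rewrite ltnS leq_eqVlt => /predU1P[E|Gk].
    by rewrite (index_inj set0 sG sF (etrans E (esym iF))).
  exact: xk.
have Aa : prefix_ideal k a.
  move=> G [sG Gk]; apply/face_ideal_monomial/subsetPn.
  have [|v [H [/setDP[vF vG] sH HF FH]]] := shs sF sG; first by rewrite iF.
  exists v => //; rewrite inE vF; apply/existsP; exists H.
  by rewrite sH -iF HF FH eqxx.
have Fa y : face_ideal F (y * a) -> face_ideal F y.
  have [_ _ prF] := face_ideal_prime K F; move/prF=> [//|].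
  by rewrite face_ideal_monomial RF.
have [_ AD AM] := vanishing_ideal (fun F => F \in s /\ (index F s < k)%N).
apply: (@PureCyclic _ _ _ _ _ a F) => // [x|y]; last first.
  split=> [yB|Fy]; first by apply/Fa/yB; rewrite iF.
  by apply: splitB; [apply: AM|rewrite mulrC; apply: FDM].
split=> [xA|[q xB]]; last first.
  rewrite -(subrK (q * a) x); apply: AD; last exact: AM.
  by move=> G [sG Gk]; apply: xB; split=> //; apply: ltnW.
have [m|q qE] := @divisible_by_monomial K T R (restr F x).
  rewrite mcoeff_restr; case: ifP => [mF xm|_]; last by rewrite eqxx.
  apply/subsetP=> v; rewrite inE => /andP[vF /existsP[H /and3P[sH Hk /eqP FH]]].
  apply: contraNT xm => vm; apply/eqP.
  have /restr_eq0P := xA H (conj sH Hk); apply; apply/subsetP=> u um.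
  have uF := subsetP mF u um; apply: contraNT vm => uH.
  have : u \in F :\: H by rewrite inE uH.
  by rewrite FH inE => /eqP <-.
exists q; apply: splitB.
  by apply: ideal_subP (vanishing_ideal _) _ _ xA _; apply: AM.
by rewrite /face_ideal raddfB /= -qE restr_id subrr.
Qed.

Lemma pure_shelling_range d i j : (i < j <= size s)%N ->
  (forall k, (i <= k < j)%N -> #|nth set0 s k| = d) ->
  pure_filtered d (prefix_ideal i) (prefix_ideal j).
Proof.
elim: j => [|j IH]; first by rewrite ltn0.
rewrite ltnS leq_eqVlt => /andP[/predU1P[<- js dk|ij js dk]].
  by rewrite -(dk i) ?leqnn ?ltnSn //; apply: pure_shelling_step.
apply: (@PureExtension _ _ _ _ (prefix_ideal j)).
  by apply: IH => [|k /andP[ik kj]]; rewrite ?ij ?(ltnW js) // dk // ik ltnW.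
by rewrite -(dk j) ?(ltnW ij) ?ltnSn //; apply: pure_shelling_step.
Qed.

Hypothesis srt : sorted (fun F G => #|G| <= #|F|)%N s.

(** In a sorted list the facets with at least [m] vertices form a prefix. *)
Lemma index_cut m F : F \in s ->
  (index F s < find (fun G : {set T} => #|G| < m)%N s)%N = (m <= #|F|)%N.
Proof.
move=> sF; set P := fun G : {set T} => _.
have iFs : (index F s < size s)%N by rewrite index_mem.
have tr : transitive (fun F G : {set T} => #|G| <= #|F|)%N.
  by move=> A B C /[swap]; apply: leq_trans.
apply/idP/idP => [iF|mF].
  by have := before_find set0 iF; rewrite nth_index // /P ltnNge => /negbFE.
rewrite ltnNge; apply: contraL mF => Fi; rewrite -ltnNge.
have hP : has P s by rewrite has_find (leq_ltn_trans Fi).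
apply: leq_ltn_trans (nth_find set0 hP).
rewrite -[in X in (X <= _)%N](nth_index set0 sF).
by apply: (sorted_leq_nth tr _ set0 srt) => //; rewrite inE -?has_find.
Qed.

Lemma pure_layer d : (exists2 F, F \in s & #|F| = d) ->
  pure_filtered d (vanishing (fun F => F \in s /\ (d < #|F|)%N))
                  (vanishing (fun F => F \in s /\ (d <= #|F|)%N)).
Proof.
move=> [F sF cF].
have cutE m p : prefix_ideal (find (fun G : {set T} => #|G| < m)%N s) p <->
    vanishing (fun F => F \in s /\ (m <= #|F|)%N) p.
  by split=> p0 G [sG Gm]; apply: p0; split=> //;
    [rewrite index_cut|rewrite -index_cut].
apply: pure_filtered_eqv (pure_shelling_range _ _) (cutE _) (cutE _).
  rewrite find_size andbT; apply: leq_ltn_trans (_ : index F s < _)%N.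
    by rewrite leqNgt index_cut // cF ltnn.
  by rewrite index_cut ?cF.
move=> k /andP[ik kj].
have ks : (k < size s)%N by apply: leq_trans kj (find_size _ _).
have := index_cut d (mem_nth set0 ks); have := index_cut d.+1 (mem_nth set0 ks).
rewrite !index_uniq // kj ltnNge ik /= => /esym/negbT.
rewrite -leqNgt => h1 /esym h2.
by apply/eqP; rewrite eqn_leq h1 h2.
Qed.

End ShellingFiltration.

Section SequentiallyCM.

Import GRing.Theory mpoly.
Local Open Scope ring_scope.

Variables (K : fieldType) (T : finType) (D : {set {set T}}).

Lemma index_sorted_leqVlt (z : seq nat) i n : sorted ltn z -> (i < size z)%N ->
  n \in z ->
  (((i <= index n z) = (nth 0 z i <= n))%N
   * ((i < index n z) = (nth 0 z i < n))%N)%type.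
Proof.
move=> sz iz nz; have nz' : (index n z < size z)%N by rewrite index_mem.
have mono j k : (j < size z)%N -> (k < size z)%N ->
    (nth 0 z j < nth 0 z k)%N = (j < k)%N.
  move=> jz kz; have inc := sorted_ltn_nth ltn_trans 0%N sz.
  case: (ltngtP j k) => [/inc->//|/inc kj|->]; last exact: ltnn.
  by apply/negbTE; rewrite -leqNgt ltnW // kj.
have := mono i _ iz nz'; have := mono _ i nz' iz.
by rewrite nth_index // !ltnNge => /negb_inj-> ->.
Qed.

(** The filtration [N i] keeps the facets whose size is at least the i-th of the
    sizes that occur, so that [N i.+1 / N i] is a layer of exactly that size. *)
Lemma shellable_sequentially_cohen_macaulay : down_closed D -> shellable D ->
  sequentially_cohen_macaulay K D.
Proof.
move=> cD /shellable_sorted[s [ps srt shs]].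
have us : uniq s by rewrite (perm_uniq ps) enum_uniq.
pose z := sort leq (undup [seq #|F : {set T}| | F <- s]).
have sz : sorted ltn z.
  rewrite ltn_sorted_uniq_leq sort_uniq undup_uniq.
  exact: (sort_sorted leq_total).
have memz n : (n \in z) = (n \in [seq #|F : {set T}| | F <- s]).
  by rewrite mem_sort mem_undup.
have zF F : F \in s -> #|F| \in z by move=> sF; rewrite memz; apply: map_f.
pose N i := vanishing (K := K) (fun F => F \in s /\ (i <= index #|F| z)%N).
have pureN i : (i < size z)%N -> pure_filtered (nth 0 z i) (N i.+1) (N i).
  move=> iz; have := mem_nth 0 iz; rewrite memz => /mapP[F sF cF].
  have pf := pure_layer K us shs srt (ex_intro2 _ _ F sF (esym cF)).
  by apply: pure_filtered_eqv pf _ _ => p; split=> p0 G [sG Gi]; apply: p0;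
    move: Gi; rewrite !(index_sorted_leqVlt sz iz (zF G sG)).
exists (size z), N; split.
- by move=> i _; apply: vanishing_graded.
- split=> p; last by move=> G [/zF zG]; rewrite leqNgt index_mem zG.
  rewrite stanley_reisner_facets //; split=> p0 G.
    by rewrite -(mem_facets_seq _ ps) => sG; apply: p0.
  by case=> sG _; apply: p0; rewrite -(mem_facets_seq _ ps).
- by move=> i _ p p0 G [sG Gi]; apply: p0; split=> //; apply: ltnW.
- by move=> i /pureN/pure_cohen_macaulay.
move=> i c d iz kc kd; have iz' := ltnW iz.
rewrite (krull_dim_unique kc (pure_krull_dim (pureN i iz'))).
rewrite (krull_dim_unique kd (pure_krull_dim (pureN i.+1 iz))).
exact: (sorted_ltn_nth ltn_trans 0%N sz).
Qed.

End SequentiallyCM.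

(** * Trees, vertex decomposability and sequential Cohen-Macaulayness *)

Theorem theorem3p2 (T : finType) (e : rel T)
    (e_sym : symmetric e) (e_irr : irreflexive e) (T_gt0 : 0 < #|T|) :
  ((exists ds : seq nat,
      size ds = #|facets (independence_complex e)| /\ dtree (compl_rel e) ds)
   <-> (vertex_decomposable (independence_complex e) /\
        quasi_forest (independence_complex e)))
  /\ (vertex_decomposable (independence_complex e) ->
      shellable (independence_complex e) /\
      forall K : fieldType,
        sequentially_cohen_macaulay K (independence_complex e)).
Proof.
have cD : down_closed (independence_complex e) by apply: complex_closed.
split; last first.
  move=> /(vertex_decomposable_shellable cD) shD; split=> // K.
  exact: shellable_sequentially_cohen_macaulay.
split=> [[ds [_ tds]]|[vdD qfD]]; first exact: tree_vd_quasi_forest tds.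
apply: shellable_quasi_forest_tree => //.
exact: vertex_decomposable_shellable.
Qed.
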